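(* Let $G$ be a group and let $\mathsf M=(A,B,X,Y,\tau_A,\tau_B)$ be a strong-graded-equivalence between partially-strongly-$G$-graded algebras $A$ and $B$. Let $\gamma^A$ and $\gamma^B$ be the canonical partial actions of $G$ on $I^A$ and $I^B$ respectively. Then $\gamma^A$ and $\gamma^B$ are Morita equivalent partial actions.
   Context: Algebras are associative, not necessarily unital, over a fixed commutative associative unital ring $k$; $G$ is an arbitrary group. Products of subsets such as $UV$ denote the $k$-span of all products $uv$. An algebra $A$ is idempotent if $A^2=A$. A $G$-graded algebra $B=\bigoplus_tB_t$ ($B_sB_t\subseteq B_{st}$) is partially-strongly-graded if $B_t=B_tB_{t^{-1}}B_t$ for all $t\in G$. A bimodule ${}_RM_S$ is unital if $RM=M=MS$. Smash product: $B\#G:=\bigoplus_{r,s\in G}B_{r^{-1}s}e_{r,s}$, a subalgebra of the algebra of $G\times G$-matrices over $B$ with finitely many nonzero entries ($b\,e_{r,s}$ has $b$ at position $(r,s)$ and $0$ elsewhere). The action $\beta^B$ of $G$ on $B\#G$ is $\beta^B_t(b\,e_{r,s})=b\,e_{tr,ts}$. The partial smash product is the two-sided ideal $I^B:=\bigoplus_{r,s\in G}B_{r^{-1}}B_se_{r,s}$ of $B\#G$. For $B$ partially-strongly-graded, $I:=I^B$ is idempotent and $I\beta^B_t(I)=\beta^B_t(I)I$ for all $t$; the canonical partial action $\gamma^B$ of $G$ on $I^B$ is the product partial action with domains $I_t:=I\beta^B_t(I)$ and isomorphisms $\gamma^B_t:=\beta^B_t|_{I_{t^{-1}}}:I_{t^{-1}}\to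 I_t$. A product partial action $\alpha$ of $G$ on an algebra $A$ is a family of two-sided ideals $D_t$ of $A$ and algebra isomorphisms $\alpha_t:D_{t^{-1}}\to D_t$ such that for all $s,t\in G$: (1) $\alpha_1=\mathrm{id}_A$; (2) $D_t^2=D_t$, $D_sD_t=D_tD_s$; (3) $\alpha_s(D_{s^{-1}}D_t)=D_sD_{st}$; (4) $\alpha_s(\alpha_t(x))=\alpha_{st}(x)$ for $x\in D_{t^{-1}}D_{(st)^{-1}}$. A Morita context $(A,B,X,Y,\tau_A,\tau_B)$ consists of algebras $A,B$, an $(A,B)$-bimodule $X$, a $(B,A)$-bimodule $Y$, an $A$-bimodule map $\tau_A:X\otimes_BY\to A$ and a $B$-bimodule map $\tau_B:Y\otimes_AX\to B$ with $\tau_A(x\otimes y)x'=x\tau_B(y\otimes x')$ and $\tau_B(y\otimes x)y'=y\tau_A(x\otimes y')$; write $xy=\tau_A(x\otimes y)$, $yx=\tau_B(y\otimes x)$. Its context algebra is the algebra of matrices $\begin{pmatrix}a&x\\ y&b\end{pmatrix}$ with the evident multiplication. It is a Morita equivalence between the idempotent algebras $A,B$ if $X,Y$ are unital bimodules and $\tau_A,\tau_B$ are surjective. Morita equivalence of product partial actions: $\alpha=\{\alpha_t:D_{t^{-1}}\to D_t\}$ on $A$ and $\alpha'=\{\alpha'_t:D'_{t^{-1}}\to D'_t\}$ on $A'$ are Morita equivalent if there exist a Morita equivalence $(A,A',X,Y,\tau_A,\tau_{A'})$ with context algebra $C$ and a product partial action $\theta=\{\theta_t:\bar D_{t^{-1}}\to\bar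 D_t\}$ of $G$ on $C$ such that (i) $YD_tX=D'_t$ for all $t$; (ii) $\theta|_A=\alpha$ and $\theta|_{A'}=\alpha'$ (identifying $A$, $A'$ with the diagonal corners of $C$; i.e. $A\cap\bar D_t=D_t$, $\theta_t=\alpha_t$ on $D_{t^{-1}}$, and similarly for $A'$). Strong-graded-equivalence: for a graded algebra $A$ put $D^A_t:=A_tA_{t^{-1}}$. A Morita context between idempotent $G$-graded algebras $A,B$ is graded if $X=\bigoplus_tX_t$, $Y=\bigoplus_tY_t$ are $G$-graded bimodules, and $\tau_A(X_r\otimes_B Y_s)\subseteq A_{rs}$, $\tau_B(Y_r\otimes_A X_s)\subseteq B_{rs}$ for all $r,s$. Suppose all $D^A_t,D^B_t$ are idempotent. A graded Morita context is strong if each $X_t$ is a unital $(D^A_t,D^B_{t^{-1}})$-bimodule and each $Y_t$ is a unital $(D^B_t,D^A_{t^{-1}})$-bimodule. A strong-graded-equivalence between $A$ and $B$ is a strong graded Morita context with $\tau_A,\tau_B$ surjective such that, for all $t\in G$, the $k$-span of $\{\tau_A(x\otimes y):x\in X_t,y\in Y_{t^{-1}}\}$ is $D^A_t$ and the $k$-span of $\{\tau_B(y\otimes x):y\in Y_t,x\in X_{t^{-1}}\}$ is $D^B_t$. *)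

(* Defs.v *)
From HB Require Import structures.
From mathcomp Require Import all_boot all_algebra finmap.
From mathcomp Require Import boolp classical_sets functions cardinality fsbigop.

Set Implicit Arguments.
Unset Strict Implicit.
Unset Printing Implicit Defensive.

Import GRing.Theory.

Local Open Scope classical_set_scope.
Local Open Scope ring_scope.

(* Associative, not necessarily unital, k-algebras; MathComp only has rings
   with a unit.                                                               *)
HB.mixin Record Lmodule_isNuAlgebra (k : comPzRingType) A
    of GRing.Lmodule k A := {
  amul : A -> A -> A;
  amulA : forall x y z, amul x (amul y z) = amul (amul x y) z;
  amulDl : forall x y z, amul (x + y) z = amul x z + amul y z;
  amulDr : forall x y z, amul x (y + z) = amul x y + amul x z;
  amulZl : forall c x y, amul (c *: x) y = c *: amul x y;
  amulZr : forall c x y, amul x (c *: y) = c *: amul x y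
}.

#[short(type="nuAlgType")]
HB.structure Definition NuAlgebra (k : comPzRingType) :=
  { A of GRing.Lmodule k A & Lmodule_isNuAlgebra k A }.

Notation "x ** y" := (amul x y) (at level 40, left associativity) : ring_scope.

Section Spans.
Context {k : comPzRingType}.

Definition kspan (V : lmodType k) (S : set V) : set V :=
  [set v | exists n (c : 'I_n -> k) (s : 'I_n -> V),
     (forall i, S (s i)) /\ v = \sum_i c i *: s i].

(* The span of all products f u v; f is the multiplication of an algebra, a
   module action, or a pairing of a Morita context.                           *)
Definition spanprod (U V : Type) (W : lmodType k) (f : U -> V -> W)
    (P : set U) (Q : set V) : set W :=
  kspan [set f u v | u in P & v in Q].

Definition submodule (V : lmodType k) (S : set V) : Prop :=
  GRing.submod_closed (fun v => v \in S).

Definition kbilinear (U V W : lmodType k) (f : U -> V -> W) : Prop :=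
  (forall u, linear (f u)) /\ (forall v, linear (f^~ v)).

(* V is the internal direct sum of the submodules V_ t. *)
Definition direct_sum (G : choiceType) (V : lmodType k) (V_ : G -> set V) :
    Prop :=
  (forall t, submodule (V_ t)) /\
  (forall v, exists! f : G -> V,
     [/\ finite_set [set t | f t != 0], (forall t, V_ t (f t)) &
         v = \sum_(t \in [set: G]) f t]).

Section Bilinear.
Variables (U V W : lmodType k) (f : U -> V -> W).
Hypothesis hf : kbilinear f.

Lemma bilinearDl u u' v : f (u + u') v = f u v + f u' v.
Proof. by have := hf.2 v 1 u u'; rewrite !scale1r. Qed.

Lemma bilinearDr u v v' : f u (v + v') = f u v + f u v'.
Proof. by have := hf.1 u 1 v v'; rewrite !scale1r. Qed.

Lemma bilinear0l v : f 0 v = 0.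
Proof. by apply: (@addrI _ (f 0 v)); rewrite -bilinearDl !addr0. Qed.

Lemma bilinear0r u : f u 0 = 0.
Proof. by apply: (@addrI _ (f u 0)); rewrite -bilinearDr !addr0. Qed.

Lemma bilinearZl c u v : f (c *: u) v = c *: f u v.
Proof. by have := hf.2 v c u 0; rewrite !addr0 bilinear0l addr0. Qed.

Lemma bilinearZr c u v : f u (c *: v) = c *: f u v.
Proof. by have := hf.1 u c v 0; rewrite !addr0 bilinear0r addr0. Qed.

End Bilinear.

Lemma submodule0 (V : lmodType k) (S : set V) : submodule S -> S 0.
Proof. by case; rewrite inE. Qed.

Lemma submoduleP (V : lmodType k) (S : set V) (c : k) u v :
  submodule S -> S u -> S v -> S (c *: u + v).
Proof. by case=> _ h Su Sv; have := h c u v; rewrite !inE; apply. Qed.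

Lemma submoduleD (V : lmodType k) (S : set V) u v :
  submodule S -> S u -> S v -> S (u + v).
Proof. by move=> hS Su Sv; have := submoduleP 1 hS Su Sv; rewrite scale1r. Qed.

Lemma submoduleZ (V : lmodType k) (S : set V) (c : k) u :
  submodule S -> S u -> S (c *: u).
Proof.
by move=> hS Su; have := submoduleP c hS Su (submodule0 hS); rewrite addr0.
Qed.

Lemma submodule_sum (V : lmodType k) (S : set V) (I : Type) (r : seq I)
    (F : I -> V) :
  submodule S -> (forall i, S (F i)) -> S (\sum_(i <- r) F i).
Proof.
move=> hS hF; elim/big_rec: _ => [|i x _ Sx]; first exact: submodule0.
exact: submoduleD.
Qed.

Lemma kspan_incl (V : lmodType k) (S : set V) : S `<=` kspan S.
Proof.
move=> v Sv; exists 1%N, (fun=> 1), (fun=> v); split=> //.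
by rewrite big_ord1 scale1r.
Qed.

Lemma kspan_submodule (V : lmodType k) (S : set V) : submodule (kspan S).
Proof.
split=> [|a u v].
  rewrite inE; exists 0%N, (fun=> 0), (fun=> 0); split; first by case.
  by rewrite big_ord0.
rewrite !inE => -[m [c [s [Ss ->]]]] [n [d [t [St ->]]]].
exists (m + n)%N,
  (fun i => match fintype.split i with inl j => a * c j | inr j => d j end),
  (fun i => match fintype.split i with inl j => s j | inr j => t j end).
split=> [i|]; first by case: fintype.split.
rewrite big_split_ord /= scaler_sumr; congr (_ + _); apply: eq_bigr => i _.
  by rewrite -[lshift _ _]/(unsplit (inl i)) unsplitK scalerA.
by rewrite -[rshift _ _]/(unsplit (inr i)) unsplitK.
Qed.

Lemma kspan_min (V : lmodType k) (S T : set V) :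
  submodule T -> S `<=` T -> kspan S `<=` T.
Proof.
move=> hT ST v [n [c [s [Ss ->]]]]; apply: submodule_sum => // i.
by apply: submoduleZ => //; exact: ST.
Qed.

Lemma spanprod_incl (U V : Type) (W : lmodType k) (f : U -> V -> W)
    (P : set U) (Q : set V) u v :
  P u -> Q v -> spanprod f P Q (f u v).
Proof. by move=> Pu Qv; apply: kspan_incl; exists u => //; exists v. Qed.

End Spans.

Section Algebras.
Context {k : comPzRingType}.

Definition aprod (A : nuAlgType k) (P Q : set A) : set A :=
  spanprod (@amul k A) P Q.

Definition idempotent_set (A : nuAlgType k) (P : set A) : Prop :=
  aprod P P = P.

Definition idempotent_alg (A : nuAlgType k) : Prop :=
  idempotent_set [set: A].

Definition two_sided_ideal (A : nuAlgType k) (J : set A) : Prop :=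
  submodule J /\ (forall a x, J x -> J (a ** x) /\ J (x ** a)).

Variable A : nuAlgType k.
Implicit Types x y : A.

Lemma amul0l y : 0 ** y = 0.
Proof. by rewrite -[X in X ** _](scale0r 0) amulZl scale0r. Qed.

Lemma amul0r x : x ** 0 = 0.
Proof. by rewrite -[X in _ ** X](scale0r 0) amulZr scale0r. Qed.

Lemma amul_suml (I : Type) (r : seq I) (F : I -> A) y :
  (\sum_(i <- r) F i) ** y = \sum_(i <- r) F i ** y.
Proof. by apply: (big_morph (fun x => x ** y)) => [? ?|]; rewrite ?amulDl ?amul0l. Qed.

Lemma amul_sumr (I : Type) (r : seq I) (F : I -> A) x :
  x ** (\sum_(i <- r) F i) = \sum_(i <- r) x ** F i.
Proof. by apply: (big_morph (fun y => x ** y)) => [? ?|]; rewrite ?amulDr ?amul0r. Qed.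

End Algebras.

Record gradedAlg (k : comPzRingType) (G : groupType) := GradedAlg {
  galg :> nuAlgType k;
  gcomp : G -> set galg;
  gcomp_direct_sum : direct_sum gcomp;
  gcomp_mul : forall s t, aprod (gcomp s) (gcomp t) `<=` gcomp (s * t)%g
}.

Arguments gcomp {k G} g t.

Section Graded.
Context {k : comPzRingType} {G : groupType} (B : gradedAlg k G).

Definition partially_strongly_graded : Prop :=
  forall t, gcomp B t =
            aprod (aprod (gcomp B t) (gcomp B t^-1%g)) (gcomp B t).

Definition gD (t : G) : set B := aprod (gcomp B t) (gcomp B t^-1%g).

Lemma gcomp_submodule t : submodule (gcomp B t).
Proof. by case: (gcomp_direct_sum B). Qed.

Lemma gcompM s t (x y : B) :
  gcomp B s x -> gcomp B t y -> gcomp B (s * t)%g (x ** y).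
Proof. by move=> hx hy; apply: gcomp_mul; exact: spanprod_incl. Qed.

End Graded.

Arguments gD {k G} B t.

Section Smash.
Context {k : comPzRingType} {G : groupType} (B : gradedAlg k G).
Implicit Types f g h : G * G -> B.

(* A matrix f stands for the sum of the f (r, s) e_{r,s}. *)
Definition smash_set : set (G * G -> B) :=
  [set f | finite_set [set p | f p != 0] /\
           (forall r s, gcomp B (r^-1 * s)%g (f (r, s)))].

Definition smash_pred : {pred G * G -> B} := fun f => f \in smash_set.

Lemma smash_predP f : reflect (smash_set f) (f \in smash_pred).
Proof. by rewrite -[_ \in _]/(f \in smash_set); apply: (iffP idP); rewrite inE. Qed.

Lemma smash_pred_closed : GRing.submod_closed smash_pred.
Proof.
split=> [|a f g].
  apply/smash_predP; split=> [|r s]; last exact: (submodule0 (gcomp_submodule B _)).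
  rewrite (_ : [set _ | _] = set0) ?finite_set0 //.
  by apply/seteqP; split=> p //=; rewrite eqxx.
move=> /smash_predP[ff hf] /smash_predP[fg hg]; apply/smash_predP; split.
  apply: (@sub_finite_set _ _ ([set p | f p != 0] `|` [set p | g p != 0])).
    move=> p /=; have [fp0|] := eqVneq (f p) 0; last by left.
    have [gp0|] := eqVneq (g p) 0; last by right.
    by rewrite -[(a *: f + g) p]/(a *: f p + g p) fp0 gp0 scaler0 addr0 eqxx.
  by rewrite finite_setU.
by move=> r s; apply: submoduleP => //; exact: gcomp_submodule.
Qed.

HB.instance Definition _ :=
  GRing.isSubmodClosed.Build k (G * G -> B) smash_pred smash_pred_closed.

Record smash := Smash { smash_val : G * G -> B; _ : smash_val \in smash_pred }.

HB.instance Definition _ := [isSub for smash_val].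
HB.instance Definition _ := [Choice of smash by <:].
HB.instance Definition _ := [SubChoice_isSubLmodule of smash by <:].

Lemma smashP (f : smash) : smash_set (\val f).
Proof. by apply/smash_predP; exact: valP. Qed.

Definition mxmul f g : G * G -> B :=
  fun p => \sum_(t \in [set: G]) f (p.1, t) ** g (t, p.2).

Lemma mxmulE (S : {fset G}) f g p :
  (forall t, t \notin S -> f (p.1, t) ** g (t, p.2) = 0) ->
  mxmul f g p = \sum_(t <- S) f (p.1, t) ** g (t, p.2).
Proof. by move=> h; rewrite /mxmul; exact: fsbigTE. Qed.

Lemma smash_bound (f : smash) : exists S : {fset G},
  forall r s, r \notin S \/ s \notin S -> \val f (r, s) = 0.
Proof.
have [ff _] := smashP f.
set T := fst @` [set p | \val f p != 0] `|` snd @` [set p | \val f p != 0].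
have fT : finite_set T by rewrite finite_setU; split; exact: finite_image.
exists (fset_set T) => r s; rewrite !in_fset_set // => h.
apply/eqP; apply: contraT => frs.
by case: h => /negP; case; rewrite inE; [left|right]; exists (r, s).
Qed.

Lemma mxmul_smash (f g : smash) : mxmul (\val f) (\val g) \in smash_pred.
Proof.
have [S hS] := smash_bound f; have [T hT] := smash_bound g.
apply/smash_predP; split; last first.
  move=> r s; apply: submodule_sum => [|t]; first exact: gcomp_submodule.
  have -> : (r^-1 * s)%g = (r^-1 * t * (t^-1 * s))%g.
    by rewrite -mulgA (mulgA t) mulgV mul1g.
  by apply: gcompM; [case: (smashP f)|case: (smashP g)].
apply: (@sub_finite_set _ _ ([set` S] `*` [set` T])); last first.
  by apply: finite_setX; exact: finite_fset.
move=> [r s] /=; apply: contra_neqP => h; rewrite /mxmul big1_seq // => t _ /=.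
have [rS|rS] := boolP (r \in S); last by rewrite hS ?amul0l //; left.
have [sT|sT] := boolP (s \in T); last by rewrite hT ?amul0r //; right.
by case: h.
Qed.

Definition smash_mul (f g : smash) : smash := Smash (mxmul_smash f g).

Fact smash_mulA x y z :
  smash_mul x (smash_mul y z) = smash_mul (smash_mul x y) z.
Proof.
have [S hS] := smash_bound x; have [T hT] := smash_bound z.
apply: val_inj; apply/funext => -[r s] /=.
rewrite (@mxmulE S) => [|t tS] /=; last by rewrite hS ?amul0l //; right.
rewrite (@mxmulE T) => [|t tT] /=; last by rewrite hT ?amul0r //; left.
transitivity (\sum_(t <- S) \sum_(u <- T)
   \val x (r, t) ** (\val y (t, u) ** \val z (u, s))).
  apply: eq_bigr => t _; rewrite (@mxmulE T) ?amul_sumr // => u uT /=.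
  by rewrite hT ?amul0r //; left.
rewrite exchange_big /=; apply: eq_bigr => u _.
rewrite (@mxmulE S) => [|t tS] /=; last by rewrite hS ?amul0l //; right.
by rewrite amul_suml; apply: eq_bigr => t _; rewrite amulA.
Qed.

Fact smash_mulDl x y z :
  smash_mul (x + y) z = smash_mul x z + smash_mul y z.
Proof.
have [T hT] := smash_bound z; apply: val_inj; apply/funext => -[r s].
have E u : \val (smash_mul u z) (r, s) =
    \sum_(t <- T) \val u (r, t) ** \val z (t, s).
  by apply: mxmulE => t tT; rewrite [X in _ ** X]hT ?amul0r //; left.
transitivity (\val (smash_mul x z) (r, s)
              + \val (smash_mul y z) (r, s)) => //.
by rewrite !E -big_split /=; apply: eq_bigr => t _; rewrite -amulDl.
Qed.

Fact smash_mulDr x y z :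
  smash_mul x (y + z) = smash_mul x y + smash_mul x z.
Proof.
have [S hS] := smash_bound x; apply: val_inj; apply/funext => -[r s].
have E u : \val (smash_mul x u) (r, s) =
    \sum_(t <- S) \val x (r, t) ** \val u (t, s).
  by apply: mxmulE => t tS; rewrite [X in X ** _]hS ?amul0l //; right.
transitivity (\val (smash_mul x y) (r, s)
              + \val (smash_mul x z) (r, s)) => //.
by rewrite !E -big_split /=; apply: eq_bigr => t _; rewrite -amulDr.
Qed.

Fact smash_mulZl c x y : smash_mul (c *: x) y = c *: smash_mul x y.
Proof.
have [T hT] := smash_bound y; apply: val_inj; apply/funext => -[r s].
have E u : \val (smash_mul u y) (r, s) =
    \sum_(t <- T) \val u (r, t) ** \val y (t, s).
  by apply: mxmulE => t tT; rewrite [X in _ ** X]hT ?amul0r //; left.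
transitivity (c *: \val (smash_mul x y) (r, s)) => //.
by rewrite !E scaler_sumr; apply: eq_bigr => t _; rewrite -amulZl.
Qed.

Fact smash_mulZr c x y : smash_mul x (c *: y) = c *: smash_mul x y.
Proof.
have [S hS] := smash_bound x; apply: val_inj; apply/funext => -[r s].
have E u : \val (smash_mul x u) (r, s) =
    \sum_(t <- S) \val x (r, t) ** \val u (t, s).
  by apply: mxmulE => t tS; rewrite [X in X ** _]hS ?amul0l //; right.
transitivity (c *: \val (smash_mul x y) (r, s)) => //.
by rewrite !E scaler_sumr; apply: eq_bigr => t _; rewrite -amulZr.
Qed.

HB.instance Definition _ := Lmodule_isNuAlgebra.Build k smash
  smash_mulA smash_mulDl smash_mulDr smash_mulZl smash_mulZr.

(* beta_t (b e_{r,s}) = b e_{tr,ts}, so entry (r, s) of beta_t f is the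
   entry (t^-1 r, t^-1 s) of f.                                             *)
Definition mxshift (t : G) f : G * G -> B :=
  fun p => f (t^-1 * p.1, t^-1 * p.2)%g.

Lemma mxshift_smash t (f : smash) : mxshift t (\val f) \in smash_pred.
Proof.
have [ff hf] := smashP f; apply/smash_predP; split=> [|r s]; last first.
  have := hf (t^-1 * r)%g (t^-1 * s)%g.
  by rewrite invgM invgK mulgA -(mulgA r^-1%g) mulgV mulg1.
apply: (@sub_finite_set _ _
  ((fun p : G * G => (t * p.1, t * p.2)%g) @` [set p | \val f p != 0])).
  move=> [r s] /= h; exists (t^-1 * r, t^-1 * s)%g => //=.
  by rewrite !mulgA mulgV !mul1g.
exact: finite_image.
Qed.

Definition smash_act (t : G) (f : smash) : smash := Smash (mxshift_smash t f).

Definition psmash_ideal : set smash :=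
  [set x : smash |
    forall r s, aprod (gcomp B r^-1%g) (gcomp B s) (\val x (r, s))].

Definition psmash_pred : {pred smash} := fun x => x \in psmash_ideal.

Lemma psmash_predP (f : smash) : reflect (psmash_ideal f) (f \in psmash_pred).
Proof. by rewrite -[_ \in _]/(f \in psmash_ideal); apply: (iffP idP); rewrite inE. Qed.

Lemma psmash_pred_closed : GRing.submod_closed psmash_pred.
Proof.
split=> [|a f g].
  by apply/psmash_predP => r s; apply: submodule0; exact: kspan_submodule.
move=> /psmash_predP hf /psmash_predP hg; apply/psmash_predP => r s.
rewrite -[X in aprod _ _ X]/(a *: \val f (r, s) + \val g (r, s)).
by apply: submoduleP => //; exact: kspan_submodule.
Qed.

HB.instance Definition _ :=
  GRing.isSubmodClosed.Build k smash psmash_pred psmash_pred_closed.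

Record psmash := PSmash { psmash_val : smash; _ : psmash_val \in psmash_pred }.

HB.instance Definition _ := [isSub for psmash_val].
HB.instance Definition _ := [Choice of psmash by <:].
HB.instance Definition _ := [SubChoice_isSubLmodule of psmash by <:].

Lemma psmash_two_sided_ideal : two_sided_ideal psmash_ideal.
Proof.
split; first exact: psmash_pred_closed.
move=> a x hx; have [_ ha] := smashP a; split=> r s.
- apply: submodule_sum => [|t]; first exact: kspan_submodule.
  have := hx t s; set v := \val x _; move: v; apply: kspan_min.
    split=> [|c u v]; rewrite !inE /=.
      by rewrite amul0r; apply: submodule0; exact: kspan_submodule.
    move=> hu hv; rewrite amulDr amulZr.
    by apply: submoduleP => //; exact: kspan_submodule.
  move=> _ [b hb [c hc <-]] /=; rewrite amulA.
  apply: spanprod_incl => //; have := gcompM (ha r t) hb.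
  by rewrite -mulgA mulgV mulg1.
- apply: submodule_sum => [|t]; first exact: kspan_submodule.
  have := hx r t; set v := \val x _; move: v; apply: kspan_min.
    split=> [|c u v]; rewrite !inE /=.
      by rewrite amul0l; apply: submodule0; exact: kspan_submodule.
    move=> hu hv; rewrite amulDl amulZl.
    by apply: submoduleP => //; exact: kspan_submodule.
  move=> _ [b hb [c hc <-]] /=; rewrite -amulA.
  apply: spanprod_incl => //; have := gcompM hc (ha t s).
  by rewrite mulgA mulgV mul1g.
Qed.

Lemma psmash_mul_subproof (x y : psmash) : \val x ** \val y \in psmash_pred.
Proof.
by apply/psmash_predP; case: psmash_two_sided_ideal => _ h;
  apply: (h _ _ _).1; apply/psmash_predP; exact: valP.
Qed.

Definition psmash_mul (x y : psmash) : psmash := PSmash (psmash_mul_subproof x y).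

Fact psmash_mulA x y z :
  psmash_mul x (psmash_mul y z) = psmash_mul (psmash_mul x y) z.
Proof. by apply: val_inj; exact: amulA. Qed.

Fact psmash_mulDl x y z :
  psmash_mul (x + y) z = psmash_mul x z + psmash_mul y z.
Proof. by apply: val_inj; exact: amulDl. Qed.

Fact psmash_mulDr x y z :
  psmash_mul x (y + z) = psmash_mul x y + psmash_mul x z.
Proof. by apply: val_inj; exact: amulDr. Qed.

Fact psmash_mulZl c x y : psmash_mul (c *: x) y = c *: psmash_mul x y.
Proof. by apply: val_inj; exact: amulZl. Qed.

Fact psmash_mulZr c x y : psmash_mul x (c *: y) = c *: psmash_mul x y.
Proof. by apply: val_inj; exact: amulZr. Qed.

HB.instance Definition _ := Lmodule_isNuAlgebra.Build k psmash
  psmash_mulA psmash_mulDl psmash_mulDr psmash_mulZl psmash_mulZr.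

End Smash.

Arguments psmash_ideal {k G} B.

(* pa_map t is a total function; only its values on pa_dom t^-1 are meaningful. *)
Record pactionData (k : comPzRingType) (G : groupType) (A : nuAlgType k) :=
  PActionData { pa_dom : G -> set A; pa_map : G -> A -> A }.

Section PartialActions.
Context {k : comPzRingType} {G : groupType}.

Definition algebra_iso_on (A : nuAlgType k) (D E : set A) (f : A -> A) : Prop :=
  [/\ set_bij D E f,
      (forall c x y, D x -> D y -> f (c *: x + y) = c *: f x + f y) &
      (forall x y, D x -> D y -> f (x ** y) = f x ** f y)].

Record product_partial_action (A : nuAlgType k) (alpha : pactionData G A) :
    Prop := {
  ppa_ideal : forall t, two_sided_ideal (pa_dom alpha t);
  ppa_iso : forall t,
    algebra_iso_on (pa_dom alpha t^-1%g) (pa_dom alpha t) (pa_map alpha t);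
  ppa_dom1 : pa_dom alpha 1%g = [set: A];
  ppa_map1 : forall x, pa_map alpha 1%g x = x;
  ppa_idem : forall t, idempotent_set (pa_dom alpha t);
  ppa_comm : forall s t,
    aprod (pa_dom alpha s) (pa_dom alpha t) =
    aprod (pa_dom alpha t) (pa_dom alpha s);
  ppa_image : forall s t,
    pa_map alpha s @` aprod (pa_dom alpha s^-1%g) (pa_dom alpha t) =
    aprod (pa_dom alpha s) (pa_dom alpha (s * t)%g);
  ppa_comp : forall s t x,
    aprod (pa_dom alpha t^-1%g) (pa_dom alpha (s * t)^-1%g) x ->
    pa_map alpha s (pa_map alpha t x) = pa_map alpha (s * t)%g x
}.

(* I_t = I beta_t(I), viewed inside the algebra I; gamma_t is beta_t on
   I_{t^-1}, and the default value 0 is only taken where beta_t x is not in I. *)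
Definition canonical_paction (B : gradedAlg k G) : pactionData G (psmash B) :=
  PActionData
    (fun t => [set x : psmash B |
       aprod (psmash_ideal B) (smash_act t @` psmash_ideal B) (\val x)])
    (fun t x => insubd (0 : psmash B) (smash_act t (\val x))).

End PartialActions.

Record bimodule (k : comPzRingType) (R S : nuAlgType k) := Bimodule {
  bimod :> lmodType k;
  lact : R -> bimod -> bimod;
  ract : bimod -> S -> bimod;
  lact_bilinear : kbilinear lact;
  ract_bilinear : kbilinear ract;
  lactA : forall a b x, lact (a ** b) x = lact a (lact b x);
  ractA : forall x a b, ract x (a ** b) = ract (ract x a) b;
  lactrA : forall a x b, ract (lact a x) b = lact a (ract x b)
}.

(* A bimodule map out of the tensor product of X and Y over B is given as the
   corresponding k-bilinear B-balanced pairing.                             *)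
Record moritaContext (k : comPzRingType) (A B : nuAlgType k) := MoritaContext {
  mcX : bimodule A B;
  mcY : bimodule B A;
  tauA : mcX -> mcY -> A;
  tauB : mcY -> mcX -> B;
  tauA_bilinear : kbilinear tauA;
  tauB_bilinear : kbilinear tauB;
  tauA_balanced : forall x b y, tauA (ract x b) y = tauA x (lact b y);
  tauB_balanced : forall y a x, tauB (ract y a) x = tauB y (lact a x);
  tauA_lact : forall a x y, tauA (lact a x) y = a ** tauA x y;
  tauA_ract : forall x y a, tauA x (ract y a) = tauA x y ** a;
  tauB_lact : forall b y x, tauB (lact b y) x = b ** tauB y x;
  tauB_ract : forall y x b, tauB y (ract x b) = tauB y x ** b;
  tauAB : forall x y x', lact (tauA x y) x' = ract x (tauB y x');
  tauBA : forall y x y', lact (tauB y x) y' = ract y (tauA x y')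
}.

Arguments mcX {k A B}.
Arguments mcY {k A B}.
Arguments tauA {k A B}.
Arguments tauB {k A B}.

Section Morita.
Context {k : comPzRingType}.

(* M is a unital (P, Q)-bimodule: the equations also say that P and Q act
   on M by restricting the actions on X.                                    *)
Definition unital (R S : nuAlgType k) (X : bimodule R S)
    (P : set R) (M : set X) (Q : set S) : Prop :=
  spanprod (@lact _ _ _ X) P M = M /\ spanprod (@ract _ _ _ X) M Q = M.

(* Surjectivity of tau as a map on the tensor product. *)
Definition surjective_tauA (A B : nuAlgType k) (M : moritaContext A B) : Prop :=
  spanprod (tauA M) [set: mcX M] [set: mcY M] = [set: A].

Definition surjective_tauB (A B : nuAlgType k) (M : moritaContext A B) : Prop :=
  spanprod (tauB M) [set: mcY M] [set: mcX M] = [set: B].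

Record morita_equivalence (A B : nuAlgType k) (M : moritaContext A B) : Prop := {
  me_idemA : idempotent_alg A;
  me_idemB : idempotent_alg B;
  me_unitalX : unital [set: A] [set: mcX M] [set: B];
  me_unitalY : unital [set: B] [set: mcY M] [set: A];
  me_surjA : surjective_tauA M;
  me_surjB : surjective_tauB M
}.

Section ContextAlgebra.
Variables (A B : nuAlgType k) (M : moritaContext A B).

(* ((a, x), (y, b)) is the matrix with rows (a x) and (y b). *)
Definition context_alg : Type := ((A * mcX M) * (mcY M * B))%type.

HB.instance Definition _ := GRing.Lmodule.on context_alg.

Definition context_mul (u v : context_alg) : context_alg :=
  let: ((a, x), (y, b)) := u in
  let: ((a', x'), (y', b')) := v in
  ((a ** a' + tauA M x y', lact a x' + ract x b'),
   (ract y a' + lact b y', tauB M y x' + b ** b')).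

Let lactX := @lact_bilinear _ _ _ (mcX M).
Let ractX := @ract_bilinear _ _ _ (mcX M).
Let lactY := @lact_bilinear _ _ _ (mcY M).
Let ractY := @ract_bilinear _ _ _ (mcY M).
Let tA := tauA_bilinear M.
Let tB := tauB_bilinear M.

Let linDl := (@amulDl, bilinearDl lactX, bilinearDl ractX, bilinearDl lactY,
              bilinearDl ractY, bilinearDl tA, bilinearDl tB).
Let linDr := (@amulDr, bilinearDr lactX, bilinearDr ractX, bilinearDr lactY,
              bilinearDr ractY, bilinearDr tA, bilinearDr tB).
Let linZl := (@amulZl, bilinearZl lactX, bilinearZl ractX, bilinearZl lactY,
              bilinearZl ractY, bilinearZl tA, bilinearZl tB).
Let linZr := (@amulZr, bilinearZr lactX, bilinearZr ractX, bilinearZr lactY,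
              bilinearZr ractY, bilinearZr tA, bilinearZr tB).

Fact context_mulA u v w :
  context_mul u (context_mul v w) = context_mul (context_mul u v) w.
Proof.
case: u v w => -[a x] [y b] [[a' x'] [y' b']] [[a'' x''] [y'' b'']].
rewrite /context_mul /= !linDl !linDr !amulA.
rewrite !tauA_lact !tauA_ract !tauB_lact !tauB_ract tauA_balanced tauB_balanced.
rewrite !lactA !ractA !lactrA !tauAB !tauBA.
by congr ((_, _), (_, _)); rewrite -!addrA; congr (_ + _); rewrite addrCA.
Qed.

Fact context_mulDl u v w :
  context_mul (u + v) w = context_mul u w + context_mul v w.
Proof.
case: u v w => -[a x] [y b] [[a' x'] [y' b']] [[a'' x''] [y'' b'']].
rewrite /context_mul /= !linDl.
by congr ((_, _), (_, _)); rewrite addrACA.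
Qed.

Fact context_mulDr u v w :
  context_mul u (v + w) = context_mul u v + context_mul u w.
Proof.
case: u v w => -[a x] [y b] [[a' x'] [y' b']] [[a'' x''] [y'' b'']].
rewrite /context_mul /= !linDr.
by congr ((_, _), (_, _)); rewrite addrACA.
Qed.

Fact context_mulZl c u v : context_mul (c *: u) v = c *: context_mul u v.
Proof.
case: u v => -[a x] [y b] [[a' x'] [y' b']].
by rewrite /context_mul /= !linZl -!scalerDr.
Qed.

Fact context_mulZr c u v : context_mul u (c *: v) = c *: context_mul u v.
Proof.
case: u v => -[a x] [y b] [[a' x'] [y' b']].
by rewrite /context_mul /= !linZr -!scalerDr.
Qed.

HB.instance Definition _ := Lmodule_isNuAlgebra.Build k context_alg
  context_mulA context_mulDl context_mulDr context_mulZl context_mulZr.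

Definition corner1 (a : A) : context_alg := ((a, 0), (0, 0)).
Definition corner2 (b : B) : context_alg := ((0, 0), (0, b)).

End ContextAlgebra.

(* theta restricts to alpha along the inclusion of a corner: the domains are
   D_t = A /\ Dbar_t and theta_t agrees with alpha_t on D_{t^-1}.            *)
Definition restricts_to (G : groupType) (A C : nuAlgType k) (incl : A -> C)
    (theta : pactionData G C) (alpha : pactionData G A) : Prop :=
  (forall t, incl @^-1` pa_dom theta t = pa_dom alpha t) /\
  (forall t a, pa_dom alpha t^-1%g a ->
     pa_map theta t (incl a) = incl (pa_map alpha t a)).

Definition morita_equivalent_pactions (G : groupType) (A A' : nuAlgType k)
    (alpha : pactionData G A) (alpha' : pactionData G A') : Prop :=
  [/\ product_partial_action alpha,
      product_partial_action alpha' &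
      exists (M : moritaContext A A') (theta : pactionData G (context_alg M)),
        [/\ morita_equivalence M,
            product_partial_action theta,
            forall t,
              spanprod (tauB M)
                (spanprod (@ract _ _ _ (mcY M)) [set: mcY M] (pa_dom alpha t))
                [set: mcX M] = pa_dom alpha' t,
            restricts_to (@corner1 A A' M) theta alpha &
            restricts_to (@corner2 A A' M) theta alpha']].

End Morita.

Record gradedMoritaContext (k : comPzRingType) (G : groupType)
    (A B : gradedAlg k G) := GradedMoritaContext {
  gmc :> moritaContext A B;
  gX : G -> set (mcX gmc);
  gY : G -> set (mcY gmc);
  gX_direct_sum : direct_sum gX;
  gY_direct_sum : direct_sum gY;
  gX_lact : forall r s,
    spanprod (@lact _ _ _ (mcX gmc)) (gcomp A r) (gX s) `<=` gX (r * s)%g;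
  gX_ract : forall r s,
    spanprod (@ract _ _ _ (mcX gmc)) (gX r) (gcomp B s) `<=` gX (r * s)%g;
  gY_lact : forall r s,
    spanprod (@lact _ _ _ (mcY gmc)) (gcomp B r) (gY s) `<=` gY (r * s)%g;
  gY_ract : forall r s,
    spanprod (@ract _ _ _ (mcY gmc)) (gY r) (gcomp A s) `<=` gY (r * s)%g;
  gtauA : forall r s,
    spanprod (tauA gmc) (gX r) (gY s) `<=` gcomp A (r * s)%g;
  gtauB : forall r s,
    spanprod (tauB gmc) (gY r) (gX s) `<=` gcomp B (r * s)%g
}.

Arguments gX {k G A B} g t.
Arguments gY {k G A B} g t.

Section StrongGradedEquivalence.
Context {k : comPzRingType} {G : groupType} (A B : gradedAlg k G).
Variable M : gradedMoritaContext A B.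

Record strong_graded_context : Prop := {
  sgc_idemA : idempotent_alg A;
  sgc_idemB : idempotent_alg B;
  sgc_idemDA : forall t, idempotent_set (gD A t);
  sgc_idemDB : forall t, idempotent_set (gD B t);
  sgc_unitalX : forall t, unital (gD A t) (gX M t) (gD B t^-1%g);
  sgc_unitalY : forall t, unital (gD B t) (gY M t) (gD A t^-1%g)
}.

Record strong_graded_equivalence : Prop := {
  sge_strong : strong_graded_context;
  sge_surjA : surjective_tauA M;
  sge_surjB : surjective_tauB M;
  sge_DA : forall t, spanprod (tauA M) (gX M t) (gY M t^-1%g) = gD A t;
  sge_DB : forall t, spanprod (tauB M) (gY M t) (gX M t^-1%g) = gD B t
}.

End StrongGradedEquivalence.

(* Main.v *)
Require Import Defs.
From HB Require Import structures.
From mathcomp Require Import all_boot all_algebra finmap.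
From mathcomp Require Import boolp classical_sets functions cardinality fsbigop.

Set Implicit Arguments.
Unset Strict Implicit.
Unset Printing Implicit Defensive.

Import GRing.Theory.

Local Open Scope classical_set_scope.
Local Open Scope ring_scope.

(** Let C be the context algebra of the graded Morita context M. It is graded by
    C_t = (A_t X_t; Y_t B_t), and the diagonal idempotents e_true, e_false of C
    act on it as multipliers, although they need not lie in C. The partial
    action that realizes the Morita equivalence is the canonical partial action
    of C on I := I^C, whose corners e I e' form the Morita context between I^A
    and I^B.

    Three facts make this work.

    - Canonical partial actions are restrictions. The ideal I^B of B#G is the
      product of the column and the row of index 1, and its translate by t is
      the product of the column and the row of index t. From
      B_t = B_t B_{t^-1} B_t these ideals are idempotent and commute with each
      other ([psmash_commuting]), and restricting a global action to an ideal
      with these properties gives a product partial action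
      ([restriction_product_partial_action]). This applies to A, to B and to C.

    - Local units of C can be cut at a corner: C_t = C_t e C_{t^-1} C_t for
      both diagonal idempotents e ([context_refines]). It is here that M has to
      be a strong-graded-equivalence: X_t and Y_t factor in this way because
      they are unital, and of the two diagonal corners one needs
      A_tA_{t^-1} = X_t Y_{t^-1} or B_tB_{t^-1} = Y_t X_{t^-1}.
      Hence C is partially-strongly-graded, and I = I e I ([psmash_full]).

    - Ideals that satisfy I = I e I are determined by any one of their corners
      ([corner_factor]). So the corners of I form a Morita equivalence, the
      domains of the action on I have as corners the domains computed inside
      the corners, and each corner of a domain generates the opposite one. This
      is [corner_pactions_morita], a statement about any global action that
      commutes with a pair of complementary idempotent multipliers.

    What remains is that the diagonal corners of I^C are I^A and I^B
    ([image_psmash_ideal]): the corner of C_s C_t is A_s A_t + X_s Y_t, and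
    X_s Y_t = A_s A_{s^-1} X_s Y_t is contained in A_s A_t. *)

(** * Spans of products *)

Section LinearMaps.
Context {k : comPzRingType} {V W : lmodType k} (h : V -> W).
Hypothesis hl : linear h.

Lemma linear_map0 : h 0 = 0.
Proof. by have := hl (-1) 0 0; rewrite scaler0 addr0 scaleN1r addNr. Qed.

Lemma linear_mapD x y : h (x + y) = h x + h y.
Proof. by have := hl 1 x y; rewrite !scale1r. Qed.

Lemma linear_map_sum (I : Type) (r : seq I) (F : I -> V) :
  h (\sum_(i <- r) F i) = \sum_(i <- r) h (F i).
Proof. by apply: (big_morph h) => [x y|]; [exact: linear_mapD|exact: linear_map0]. Qed.

Lemma submodule_preimage (T : set W) : submodule T -> submodule (h @^-1` T).
Proof.
move=> hT; split=> [|c u v]; rewrite !inE /=.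
  by rewrite linear_map0; exact: submodule0.
by move=> hu hv; rewrite hl; exact: submoduleP.
Qed.

Lemma submodule_image (T : set V) : submodule T -> submodule (h @` T).
Proof.
move=> hT; split=> [|c u v]; rewrite !inE /=.
  by exists 0; [exact: submodule0|exact: linear_map0].
move=> [x Tx <-] [y Ty <-]; exists (c *: x + y); last exact: hl.
exact: submoduleP.
Qed.

End LinearMaps.

Section Submodules.
Context {k : comPzRingType}.

Lemma submoduleI (V : lmodType k) (S T : set V) :
  submodule S -> submodule T -> submodule (S `&` T).
Proof.
move=> hS hT; split=> [|c u v]; rewrite !inE /=.
  by split; exact: submodule0.
by move=> [? ?] [? ?]; split; exact: submoduleP.
Qed.

Lemma spanprod_sub (U V : Type) (W : lmodType k) (f : U -> V -> W)
    (P : set U) (Q : set V) (T : set W) :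
  submodule T -> (forall u v, P u -> Q v -> T (f u v)) ->
  spanprod f P Q `<=` T.
Proof.
move=> hT h; apply: kspan_min => // _ [u Pu [v Qv <-]]; exact: h.
Qed.

Lemma spanprod_sub_linear (U V : Type) (W W' : lmodType k) (f : U -> V -> W)
    (P : set U) (Q : set V) (h : W -> W') (T : set W') :
  linear h -> submodule T -> (forall u v, P u -> Q v -> T (h (f u v))) ->
  forall w, spanprod f P Q w -> T (h w).
Proof.
by move=> hl hT hPQ; apply: (spanprod_sub (T := h @^-1` T)) => //;
  exact: submodule_preimage.
Qed.

Lemma spanprod_submodule (U V : Type) (W : lmodType k) (f : U -> V -> W)
    (P : set U) (Q : set V) : submodule (spanprod f P Q).
Proof. exact: kspan_submodule. Qed.

Lemma spanprodS (U V : Type) (W : lmodType k) (f : U -> V -> W)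
    (P P' : set U) (Q Q' : set V) :
  P `<=` P' -> Q `<=` Q' -> spanprod f P Q `<=` spanprod f P' Q'.
Proof.
move=> hP hQ; apply: spanprod_sub => [|u v Pu Qv].
  exact: spanprod_submodule.
by apply: spanprod_incl; [exact: hP|exact: hQ].
Qed.

(** Images commute with spans of products; this transports every product from
    an algebra to the ambient algebra in which it is computed. *)
Lemma spanprod_image (U V U' V' : Type) (W W' : lmodType k)
    (f : U -> V -> W) (g : U' -> V' -> W')
    (p : U -> U') (q : V -> V') (h : W -> W') (P : set U) (Q : set V) :
  linear h -> (forall u v, h (f u v) = g (p u) (q v)) ->
  h @` spanprod f P Q = spanprod g (p @` P) (q @` Q).
Proof.
move=> hl hfg; apply/seteqP; split.
  move=> _ [w + <-]; move: w; apply: spanprod_sub_linear => // [|u v Pu Qv].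
    exact: spanprod_submodule.
  by rewrite hfg; apply: spanprod_incl; [exists u|exists v].
apply: spanprod_sub => [|_ _ [u Pu <-] [v Qv <-]].
  by apply: submodule_image => //; exact: spanprod_submodule.
by exists (f u v); [exact: spanprod_incl|rewrite hfg].
Qed.

Lemma spanprod_nest_l (U V R : Type) (W Z : lmodType k) (f : W -> R -> Z)
    (g : U -> V -> W) (P : set U) (Q : set V) (S : set R) (T : set Z) :
  (forall r, linear (f^~ r)) -> submodule T ->
  (forall u v r, P u -> Q v -> S r -> T (f (g u v) r)) ->
  spanprod f (spanprod g P Q) S `<=` T.
Proof.
move=> lf hT h; apply: spanprod_sub => // w r + Sr; move: w.
by apply: (spanprod_sub_linear (lf r)) => // u v Pu Qv; exact: h.
Qed.

Lemma spanprod_nest_r (U V R : Type) (W Z : lmodType k) (f : R -> W -> Z)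
    (g : U -> V -> W) (P : set U) (Q : set V) (S : set R) (T : set Z) :
  (forall r, linear (f r)) -> submodule T ->
  (forall r u v, S r -> P u -> Q v -> T (f r (g u v))) ->
  spanprod f S (spanprod g P Q) `<=` T.
Proof.
move=> lf hT h; apply: spanprod_sub => // r w Sr; move: w.
by apply: (spanprod_sub_linear (lf r)) => // u v Pu Qv; exact: h.
Qed.

Context {A : nuAlgType k}.
Implicit Types P Q R T : set A.

Lemma amull_linear (a : A) : linear (fun x => a ** x).
Proof. by move=> c x y; rewrite amulDr amulZr. Qed.

Lemma amulr_linear (a : A) : linear (fun x => x ** a).
Proof. by move=> c x y; rewrite amulDl amulZl. Qed.

Lemma aprod_submodule P Q : submodule (aprod P Q).
Proof. exact: kspan_submodule. Qed.

Lemma aprod_incl P Q x y : P x -> Q y -> aprod P Q (x ** y).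
Proof. exact: spanprod_incl. Qed.

Lemma aprodS P P' Q Q' :
  P `<=` P' -> Q `<=` Q' -> aprod P Q `<=` aprod P' Q'.
Proof. exact: spanprodS. Qed.

Lemma aprod3_sub P Q R T :
  submodule T -> (forall x y z, P x -> Q y -> R z -> T (x ** y ** z)) ->
  aprod (aprod P Q) R `<=` T.
Proof. by apply: spanprod_nest_l => x; exact: amulr_linear. Qed.

Lemma aprodA P Q R : aprod P (aprod Q R) = aprod (aprod P Q) R.
Proof.
apply/seteqP; split.
  apply: spanprod_nest_r => [x||x y z Px Qy Rz].
  - exact: amull_linear.
  - exact: aprod_submodule.
  - by rewrite amulA; do !apply: aprod_incl.
apply: aprod3_sub => [|x y z Px Qy Rz]; first exact: aprod_submodule.
by rewrite -amulA; do !apply: aprod_incl.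
Qed.

Lemma ideal_l (J : set A) : two_sided_ideal J -> aprod [set: A] J `<=` J.
Proof.
by move=> [hJ h]; apply: spanprod_sub => // a x _ Jx; exact: (h _ _ _).1.
Qed.

Lemma ideal_r (J : set A) : two_sided_ideal J -> aprod J [set: A] `<=` J.
Proof.
by move=> [hJ h]; apply: spanprod_sub => // a x Jx _; exact: (h _ _ _).2.
Qed.

Lemma aprod_subl (J P : set A) : two_sided_ideal J -> aprod J P `<=` J.
Proof. by move=> hJ; apply: subset_trans (ideal_r hJ); exact: aprodS. Qed.

Lemma aprod_subr (J P : set A) : two_sided_ideal J -> aprod P J `<=` J.
Proof. by move=> hJ; apply: subset_trans (ideal_l hJ); exact: aprodS. Qed.

Lemma aprod_ideal (J K : set A) :
  two_sided_ideal J -> two_sided_ideal K -> two_sided_ideal (aprod J K).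
Proof.
move=> [_ hJ] [_ hK]; split; first exact: aprod_submodule.
move=> a x Jx; split; move: x Jx.
  apply: spanprod_sub_linear.
  - exact: amull_linear.
  - exact: aprod_submodule.
  - by move=> x y Jx Ky; rewrite amulA; apply: aprod_incl => //;
      exact: (hJ _ _ _).1.
apply: (spanprod_sub_linear (h := fun w => w ** a)).
- exact: amulr_linear.
- exact: aprod_submodule.
- by move=> x y Jx Ky; rewrite -amulA; apply: aprod_incl => //;
    exact: (hK _ _ _).2.
Qed.

End Submodules.

Definition alg_hom (k : comPzRingType) (A B : nuAlgType k) (h : A -> B) :=
  linear h /\ {morph h : x y / x ** y}.

Section AlgHom.
Context {k : comPzRingType} {A B : nuAlgType k} (h : A -> B).
Hypothesis hh : alg_hom h.

Lemma aprod_image P Q : h @` aprod P Q = aprod (h @` P) (h @` Q).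
Proof. by apply: spanprod_image; [exact: hh.1|exact: hh.2]. Qed.

End AlgHom.

(** * Restricting a global action to an ideal *)

(** The conjugates of the ideal [I] are idempotent and commute pairwise, and
    every product of domains is a product of such conjugates; the axioms of a
    product partial action become identities in that commutative band. *)
Section Restriction.
Context {k : comPzRingType} {G : groupType} {S : nuAlgType k}.
Variables (beta : G -> S -> S) (I : set S).

Record global_action : Prop := {
  ga_hom : forall t, alg_hom (beta t);
  ga1 : forall x, beta 1%g x = x;
  gaM : forall s t x, beta s (beta t x) = beta (s * t)%g x
}.

Record commuting_ideal : Prop := {
  ci_ideal : two_sided_ideal I;
  ci_idem : aprod I I = I;
  ci_comm : forall t, aprod I (beta t @` I) = aprod (beta t @` I) I
}.

Hypothesis hb : global_action.
Hypothesis hI : commuting_ideal.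

Local Notation J t := (beta t @` I).

Lemma gaK t : cancel (beta t) (beta t^-1%g).
Proof. by move=> x; rewrite (gaM hb) mulVg (ga1 hb). Qed.

Lemma gaVK t : cancel (beta t^-1%g) (beta t).
Proof. by move=> x; rewrite (gaM hb) mulgV (ga1 hb). Qed.

Lemma conj1 : J 1%g = I.
Proof.
apply/seteqP; split=> [_ [x Ix <-]|x Ix]; first by rewrite (ga1 hb).
by exists x; rewrite ?(ga1 hb).
Qed.

Lemma conjM s t : beta s @` J t = J (s * t)%g.
Proof. by rewrite image_comp; apply: eq_imagel => x _ /=; rewrite (gaM hb). Qed.

Lemma conj_ideal t : two_sided_ideal (J t).
Proof.
split; first exact: submodule_image (ga_hom hb t).1 _ (ci_ideal hI).1.
move=> a _ [x Ix <-]; rewrite -(gaVK t a) -!(ga_hom hb t).2.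
by split; [exists (beta t^-1%g a ** x)|exists (x ** beta t^-1%g a)] => //;
  have [] := (ci_ideal hI).2 (beta t^-1%g a) x Ix.
Qed.

Lemma conj_idem t : aprod (J t) (J t) = J t.
Proof. by rewrite -(aprod_image (ga_hom hb t)) (ci_idem hI). Qed.

Lemma conj_comm s t : aprod (J s) (J t) = aprod (J t) (J s).
Proof.
rewrite -[t in LHS](mulVKg s) -[in RHS](mulVKg s t) -!(conjM s).
by rewrite -!(aprod_image (ga_hom hb s)) (ci_comm hI).
Qed.

Definition restricted_dom t : set S := aprod I (J t).

Lemma restricted_dom_ideal t : two_sided_ideal (restricted_dom t).
Proof. by apply: aprod_ideal; [exact: (ci_ideal hI)|exact: conj_ideal]. Qed.

Lemma restricted_domS t : restricted_dom t `<=` I.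
Proof. exact: aprod_subl (ci_ideal hI). Qed.

Lemma restricted_dom_conjS t : restricted_dom t `<=` J t.
Proof. exact: aprod_subr (conj_ideal t). Qed.

Lemma restricted_dom1 : restricted_dom 1%g = I.
Proof. by rewrite /restricted_dom conj1 (ci_idem hI). Qed.

Lemma aprod_restricted_dom s t :
  aprod (restricted_dom s) (restricted_dom t) = aprod (restricted_dom s) (J t).
Proof.
rewrite /restricted_dom aprodA -[X in aprod X _]aprodA -(ci_comm hI s).
by rewrite aprodA (ci_idem hI).
Qed.

Lemma restricted_dom_idem t :
  aprod (restricted_dom t) (restricted_dom t) = restricted_dom t.
Proof.
by rewrite aprod_restricted_dom /restricted_dom -aprodA conj_idem.
Qed.

Lemma restricted_dom_act t : beta t @` restricted_dom t^-1%g = restricted_dom t.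
Proof.
rewrite /restricted_dom (aprod_image (ga_hom hb t)) conjM mulgV conj1.
by rewrite (ci_comm hI).
Qed.

Section Transport.
Context {A : nuAlgType k}.
Variables (iota : A -> S) (alpha : pactionData G A).

(** Required on the domains only, since [pa_map alpha t] carries no information
    outside [pa_dom alpha t^-1]. *)
Definition intertwines : Prop := forall t x,
  pa_dom alpha t^-1%g x -> iota (pa_map alpha t x) = beta t (iota x).

Hypothesis hi : alg_hom iota.
Hypothesis iota_inj : injective iota.
Hypothesis iota_range : range iota = I.
Hypothesis iota_dom : forall t, pa_dom alpha t = iota @^-1` restricted_dom t.
Hypothesis iota_map : intertwines.

Lemma image_restricted_dom t : iota @` pa_dom alpha t = restricted_dom t.
Proof.
rewrite iota_dom; apply/seteqP; split=> [|x hx]; first exact: image_preimage_subset.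
have : range iota x by rewrite iota_range; exact: restricted_domS hx.
by case=> a _ ax; exists a; rewrite /= ?ax.
Qed.

Lemma inj_image (P Q : set A) : iota @` P = iota @` Q -> P = Q.
Proof.
move=> PQ; apply/seteqP; split=> x hx.
  by have : (iota @` Q) (iota x) by [rewrite -PQ; exists x];
    case=> y Qy /iota_inj <-.
by have : (iota @` P) (iota x) by [rewrite PQ; exists x];
  case=> y Qy /iota_inj <-.
Qed.

Lemma restricted_dom_preimage_ideal t : two_sided_ideal (pa_dom alpha t).
Proof.
rewrite iota_dom; split.
  exact: submodule_preimage hi.1 _ (restricted_dom_ideal t).1.
move=> a x /= hx; rewrite !hi.2.
by have [] := (restricted_dom_ideal t).2 (iota a) _ hx.
Qed.

Lemma restricted_dom_map t x :
  pa_dom alpha t^-1%g x -> pa_dom alpha t (pa_map alpha t x).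
Proof.
move=> hx; rewrite iota_dom /= (iota_map hx) -restricted_dom_act.
by exists (iota x) => //; rewrite iota_dom in hx.
Qed.

Theorem restriction_product_partial_action : product_partial_action alpha.
Proof.
have idm s t : aprod (pa_dom alpha s) (pa_dom alpha t) `<=` pa_dom alpha s.
  exact: aprod_subl (restricted_dom_preimage_ideal s).
have im_map s (Z : set A) : Z `<=` pa_dom alpha s^-1%g ->
    iota @` (pa_map alpha s @` Z) = beta s @` (iota @` Z).
  by move=> hZ; rewrite !image_comp; apply: eq_imagel => x /hZ /iota_map.
have dom1 : pa_dom alpha 1%g = [set: A].
  by apply: inj_image; rewrite image_restricted_dom restricted_dom1.
split=> //.
- exact: restricted_dom_preimage_ideal.
- move=> t; split; first split.
  + by move=> x; exact: restricted_dom_map.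
  + move=> x y; rewrite !inE => hx hy exy; apply: iota_inj.
    by apply: (can_inj (gaK t)); rewrite -!iota_map ?exy.
  + move=> y hy; have : restricted_dom t (iota y) by rewrite iota_dom in hy.
    rewrite -restricted_dom_act -image_restricted_dom => -[_ [x hx <-] e].
    by exists x => //; apply: iota_inj; rewrite iota_map.
  + move=> c x y hx hy; apply: iota_inj.
    rewrite iota_map; last first.
      exact: submoduleP (restricted_dom_preimage_ideal _).1 hx hy.
    by rewrite hi.1 (ga_hom hb t).1 hi.1 !iota_map.
  + move=> x y hx hy; apply: iota_inj; rewrite hi.2 !iota_map //.
      by rewrite hi.2 (ga_hom hb t).2.
    exact: ((restricted_dom_preimage_ideal _).2 x y hy).1.
- move=> x; apply: iota_inj; rewrite iota_map ?(ga1 hb) //.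
  by rewrite invg1 dom1.
- move=> t; apply: inj_image.
  by rewrite (aprod_image hi) !image_restricted_dom restricted_dom_idem.
- move=> s t; apply: inj_image.
  rewrite !(aprod_image hi) !image_restricted_dom !aprod_restricted_dom.
  by rewrite /restricted_dom -!aprodA (conj_comm s).
- move=> s t; apply: inj_image.
  rewrite im_map //.
  rewrite !(aprod_image hi) !image_restricted_dom !aprod_restricted_dom.
  by rewrite (aprod_image (ga_hom hb s)) restricted_dom_act conjM.
- move=> s t x hx; apply: iota_inj.
  have ht : pa_dom alpha t^-1%g x := idm _ _ _ hx.
  have hst : pa_dom alpha (s * t)^-1%g x.
    exact: aprod_subr (restricted_dom_preimage_ideal _) _ hx.
  rewrite (iota_map hst) -(gaM hb) -(iota_map ht) iota_map //.
  rewrite iota_dom /= (iota_map ht).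
  have : (beta t @` (iota @` aprod (pa_dom alpha t^-1%g)
                                   (pa_dom alpha (s * t)^-1%g)))
         (beta t (iota x)) by exists (iota x) => //; exists x.
  rewrite (aprod_image hi) !image_restricted_dom aprod_restricted_dom.
  rewrite (aprod_image (ga_hom hb t)) restricted_dom_act conjM.
  rewrite invgM mulgA mulgV mul1g; move: (beta t _).
  by apply: aprodS => //; exact: restricted_domS.
Qed.

End Transport.
End Restriction.
(** * Idempotent multipliers and the Morita context of an ideal *)

(** A pair of complementary idempotent multipliers of [S]: [pL b] and [pR b] are
    the multiplications on the left and on the right by an idempotent e_b that
    need not lie in [S], with e_true + e_false = 1. *)
Record peirce (k : comPzRingType) (S : nuAlgType k) := Peirce {
  pL : bool -> S -> S;
  pR : bool -> S -> S;
  pL_linear : forall b, linear (pL b);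
  pR_linear : forall b, linear (pR b);
  pLM : forall b x y, pL b (x ** y) = pL b x ** y;
  pRM : forall b x y, pR b (x ** y) = x ** pR b y;
  pRL : forall b x y, pR b x ** y = x ** pL b y;
  pLL : forall b c x, pL b (pL c x) = if b == c then pL b x else 0;
  pRR : forall b c x, pR b (pR c x) = if b == c then pR b x else 0;
  pLR : forall b c x, pL b (pR c x) = pR c (pL b x);
  pL_sum : forall x, pL true x + pL false x = x;
  pR_sum : forall x, pR true x + pR false x = x
}.

Section Corners.
Context {k : comPzRingType} {S : nuAlgType k} (p : peirce S).
Implicit Types (J : set S) (x y z : S).

Definition corner J b c : set S := [set x | [/\ J x, pL p b x = x & pR p c x = x]].

Lemma corner_submodule J b c : submodule J -> submodule (corner J b c).
Proof.
move=> hJ; split=> [|a u v]; rewrite !inE.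
  split; first exact: submodule0.
    exact: linear_map0 (pL_linear p b).
  exact: linear_map0 (pR_linear p c).
move=> [Ju lu ru] [Jv lv rv]; split; first exact: submoduleP.
  by rewrite pL_linear lu lv.
by rewrite pR_linear ru rv.
Qed.

Lemma pL_idem b x : pL p b (pL p b x) = pL p b x.
Proof. by rewrite pLL eqxx. Qed.

Lemma pR_idem b x : pR p b (pR p b x) = pR p b x.
Proof. by rewrite pRR eqxx. Qed.

(** A multiplier need not preserve an ideal, but it preserves an idempotent
    one, since e(xy) = (ex)y. *)
Lemma pL_stable J b x :
  two_sided_ideal J -> idempotent_set J -> J x -> J (pL p b x).
Proof.
move=> hJ idJ; rewrite -[in X in X -> _]idJ; move: x; apply: spanprod_sub_linear.
- exact: pL_linear.
- exact: hJ.1.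
- by move=> u v _ Jv; rewrite pLM; exact: (hJ.2 _ _ _).1.
Qed.

Lemma pR_stable J b x :
  two_sided_ideal J -> idempotent_set J -> J x -> J (pR p b x).
Proof.
move=> hJ idJ; rewrite -[in X in X -> _]idJ; move: x; apply: spanprod_sub_linear.
- exact: pR_linear.
- exact: hJ.1.
- by move=> u v Ju _; rewrite pRM; exact: (hJ.2 _ _ _).2.
Qed.

Lemma cornerP J b c x : J (pL p b (pR p c x)) -> corner J b c (pL p b (pR p c x)).
Proof. by move=> h; split; rewrite // ?pL_idem // -pLR pR_idem. Qed.

Lemma corner_orth J J' b c c' d x y :
  corner J b c x -> corner J' c' d y -> c != c' -> x ** y = 0.
Proof.
move=> [_ _ rx] [_ ly _] cc'.
by rewrite -rx pRL -ly pLL (negPf cc') amul0r.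
Qed.

Lemma cornerM J J' K b c c' d x y :
  corner J b c x -> corner J' c' d y -> K (x ** y) -> corner K b d (x ** y).
Proof.
by move=> [_ lx _] [_ _ ry] hK; split; rewrite ?pLM ?pRM ?lx ?ry.
Qed.

Lemma pL_corner J b c d x : corner J b c x -> pL p d x = if d == b then x else 0.
Proof. by move=> [_ lx _]; rewrite -lx pLL; case: eqP => // ->. Qed.

Lemma pR_corner J b c d x : corner J b c x -> pR p d x = if d == c then x else 0.
Proof. by move=> [_ _ rx]; rewrite -rx pRR; case: eqP => // ->. Qed.

Definition full J : Prop := forall d, J `<=` aprod (pR p d @` J) J.

(** The inserted factors e_d and e_d' cut the product I1 J I2 into corners; each
    corner of an ideal is thus recovered from any other one. *)
Lemma corner_factor I1 I2 J b c d d' :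
  two_sided_ideal I1 -> two_sided_ideal I2 -> two_sided_ideal J ->
  idempotent_set I1 -> idempotent_set I2 -> idempotent_set J ->
  full I1 -> full I2 -> J `<=` aprod (aprod I1 J) I2 ->
  corner J b c `<=`
    aprod (aprod (corner I1 b d) (corner J d d')) (corner I2 d' c).
Proof.
move=> h1 h2 hJ i1 i2 iJ f1 f2 fJ x [Jx lx rx].
set T := aprod _ _; have hT : submodule T by exact: aprod_submodule.
have lin : linear (fun z => pL p b (pR p c z)).
  by move=> a u v; rewrite pR_linear pL_linear.
have Tprod u j w : J j -> I1 u -> I2 w -> T (pL p b (pR p c (u ** j ** w))).
  move=> Jj I1u I2w.
  have Jmid v j' v' : J j' -> J (v ** j' ** v').
    by move=> Jj'; apply: (hJ.2 _ _ _).2; exact: (hJ.2 _ _ _).1.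
  move/(f1 d): I1u; move: u.
  apply: (spanprod_sub_linear
            (T := T) (h := fun u => pL p b (pR p c (u ** j ** w)))) => //.
    by move=> a u v; rewrite !amulDl !amulZl lin.
  move=> _ v [u I1u <-] I1v; move/(f2 d'): I2w; move: w.
  apply: (spanprod_sub_linear
           (T := T) (h := fun w => pL p b (pR p c (pR p d u ** v ** j ** w)))) => //.
    by move=> a w w'; rewrite !amulDr !amulZr lin.
  move=> _ w [v' I2v' <-] I2w.
  have -> : pL p b (pR p c (pR p d u ** v ** j ** (pR p d' v' ** w))) =
            pL p b (pR p d u) ** pL p d (pR p d' (v ** j ** v')) **
            pL p d' (pR p c w).
    rewrite -[RHS]pRL [in RHS]pRM -(pLR p d d') pR_idem -(pRL p d).
    rewrite -(pLR p b d) pR_idem [in RHS]pLR.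
    by rewrite -pLR !pRM !pLM !amulA.
  have stable I' z b' c' : two_sided_ideal I' -> idempotent_set I' -> I' z ->
      corner I' b' c' (pL p b' (pR p c' z)).
    by move=> h i I'z; apply: cornerP; apply: pL_stable => //; exact: pR_stable.
  by apply: aprod_incl; [apply: aprod_incl|]; apply: stable => //; exact: Jmid.
rewrite -lx -rx; move/fJ: Jx; move: x {lx rx}.
apply: (spanprod_sub_linear lin) => // z w + I2w; move: z.
apply: (spanprod_sub_linear (T := T) (h := fun z => pL p b (pR p c (z ** w)))) => //.
  by move=> a u v; rewrite !amulDl !amulZl lin.
by move=> u j I1u Jj; exact: Tprod.
Qed.

End Corners.
(** Bundling the closure proof with the set lets the subtype of a corner carry
    a module structure. *)
Record submod (k : comPzRingType) (V : lmodType k) := Submod {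
  submod_set :> set V;
  submodP : submodule submod_set
}.

Section SubmoduleType.
Context {k : comPzRingType} {V : lmodType k} (W : submod V).

Definition submod_pred : {pred V} := fun v => v \in (W : set V).

Lemma submod_predP v : reflect (submod_set W v) (v \in submod_pred).
Proof.
by rewrite -[_ \in _]/(v \in (W : set V)); apply: (iffP idP); rewrite inE.
Qed.

Lemma submod_pred_closed : GRing.submod_closed submod_pred.
Proof. exact: submodP. Qed.

HB.instance Definition _ :=
  GRing.isSubmodClosed.Build k V submod_pred submod_pred_closed.

Record submod_type :=
  SubmodType { submod_val : V; _ : submod_val \in submod_pred }.

HB.instance Definition _ := [isSub for submod_val].
HB.instance Definition _ := [Choice of submod_type by <:].
HB.instance Definition _ := [SubChoice_isSubLmodule of submod_type by <:].

Lemma submod_valP (v : submod_type) : submod_set W (\val v).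
Proof. by apply/submod_predP; exact: valP. Qed.

Definition to_submod v (Wv : submod_set W v) : submod_type :=
  SubmodType (introT (submod_predP v) Wv).

Lemma range_submod_val : range (\val : submod_type -> V) = W.
Proof.
apply/seteqP; split=> [_ [v _ <-]|v Wv]; first exact: submod_valP.
by exists (to_submod Wv).
Qed.

Lemma submod_val_linear : linear (\val : submod_type -> V).
Proof. by move=> c u v; rewrite linearP. Qed.

End SubmoduleType.

Section IdealContext.
Context {k : comPzRingType} {S : nuAlgType k} (p : peirce S).
Variables (I : set S) (hI : two_sided_ideal I) (idI : idempotent_set I).
Hypothesis fullI : full p I.

Record corner_embedding (b : bool) (A : nuAlgType k) (i : A -> S) : Prop := {
  ce_hom : alg_hom i;
  ce_inj : injective i;
  ce_range : range i = corner p I b b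
}.

Lemma corner_mul b c d x y :
  corner p I b c x -> corner p I c d y -> corner p I b d (x ** y).
Proof.
by move=> hx hy; apply: (cornerM hx hy); case: hx => Ix _ _; exact: (hI.2 _ _ _).2.
Qed.

(** Unitality of the corner bimodules, surjectivity of the pairings and
    idempotency of the diagonal corners are instances of this identity. *)
Lemma corner_refine b c d :
  corner p I b c = aprod (corner p I b d) (corner p I d c).
Proof.
have mul e f g : aprod (corner p I e f) (corner p I f g) `<=` corner p I e g.
  apply: spanprod_sub; first exact: corner_submodule hI.1.
  by move=> x y; exact: corner_mul.
apply/seteqP; split; last exact: mul.
apply: subset_trans (corner_factor d d hI hI hI idI idI idI fullI fullI _) _.
  by rewrite idI idI.
by rewrite -aprodA; apply: aprodS; last exact: mul.
Qed.

Definition corner_submod b c : submod S := Submod (corner_submodule p b c hI.1).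

Definition cornerT b c := submod_type (corner_submod b c).

Lemma embed_corner b (A : nuAlgType k) (i : A -> S) :
  corner_embedding b i -> forall a, corner p I b b (i a).
Proof. by move=> h a; rewrite -(ce_range h); exists a. Qed.

Section CornerBimodule.
Variables (b c : bool) (A B : nuAlgType k) (iA : A -> S) (iB : B -> S).
Hypotheses (hA : corner_embedding b iA) (hB : corner_embedding c iB).

Definition corner_lact a (x : cornerT b c) : cornerT b c :=
  @to_submod _ _ (corner_submod b c) _
    (corner_mul (embed_corner hA a) (submod_valP x)).

Definition corner_ract (x : cornerT b c) a : cornerT b c :=
  @to_submod _ _ (corner_submod b c) _
    (corner_mul (submod_valP x) (embed_corner hB a)).

Lemma corner_lact_bilinear : kbilinear corner_lact.
Proof.
split=> [a|x] m u v; apply: val_inj; rewrite submod_val_linear /=.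
  by rewrite amulDr amulZr.
by rewrite (ce_hom hA).1 amulDl amulZl.
Qed.

Lemma corner_ract_bilinear : kbilinear corner_ract.
Proof.
split=> [a|x] m u v; apply: val_inj; rewrite submod_val_linear /=.
  by rewrite (ce_hom hB).1 amulDr amulZr.
by rewrite amulDl amulZl.
Qed.

Lemma corner_lactA a a' x :
  corner_lact (a ** a') x = corner_lact a (corner_lact a' x).
Proof. by apply: val_inj; rewrite /= (ce_hom hA).2 amulA. Qed.

Lemma corner_ractA x a a' :
  corner_ract x (a ** a') = corner_ract (corner_ract x a) a'.
Proof. by apply: val_inj; rewrite /= (ce_hom hB).2 amulA. Qed.

Lemma corner_lactrA a x a' :
  corner_ract (corner_lact a x) a' = corner_lact a (corner_ract x a').
Proof. by apply: val_inj; rewrite /= amulA. Qed.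

Definition corner_bimodule : bimodule A B :=
  Bimodule corner_lact_bilinear corner_ract_bilinear
    corner_lactA corner_ractA corner_lactrA.

Lemma corner_unital :
  unital [set: A] [set: corner_bimodule] [set: B].
Proof.
split; apply/seteqP; split=> // x _.
  have : (\val @` spanprod corner_lact [set: A] [set: cornerT b c]) (\val x).
    rewrite (spanprod_image (g := @amul k S) (p := iA) (q := \val)) //.
    rewrite (ce_range hA) range_submod_val -/(aprod _ _) -corner_refine.
    exact: (submod_valP x).
  by case=> y hy /val_inj <-.
have : (\val @` spanprod corner_ract [set: cornerT b c] [set: B]) (\val x).
  rewrite (spanprod_image (g := @amul k S) (p := \val) (q := iB)) //.
    rewrite (ce_range hB) range_submod_val -/(aprod _ _) -corner_refine.
    exact: (submod_valP x).
by case=> y hy /val_inj <-.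
Qed.

(** The product of [x] and [y] in [S], pulled back along [iA]; it lies in the
    range of [iA], so the default 0 is never taken. *)
Definition corner_pairing (x : cornerT b c) (y : cornerT c b) : A :=
  xget 0 [set a | iA a = \val x ** \val y].

Lemma corner_pairingE x y : iA (corner_pairing x y) = \val x ** \val y.
Proof.
have : range iA (\val x ** \val y).
  by rewrite (ce_range hA); exact: corner_mul (submod_valP x) (submod_valP y).
by case=> a _ ea; apply: (@xgetPex _ 0 [set a | iA a = \val x ** \val y]); exists a.
Qed.

Lemma corner_pairing_bilinear : kbilinear corner_pairing.
Proof.
split=> [x|y] m u v; apply: (ce_inj hA); rewrite (ce_hom hA).1 !corner_pairingE.
  by rewrite submod_val_linear amulDr amulZr.
by rewrite submod_val_linear amulDl amulZl.
Qed.

Lemma image_corner_pairing (P : set (cornerT b c)) (Q : set (cornerT c b)) :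
  iA @` spanprod corner_pairing P Q = aprod (\val @` P) (\val @` Q).
Proof.
by apply: spanprod_image; [exact: (ce_hom hA).1|exact: corner_pairingE].
Qed.

Lemma corner_pairing_surj : spanprod corner_pairing setT setT = [set: A].
Proof.
apply: (inj_image (ce_inj hA)); rewrite image_corner_pairing !range_submod_val.
by rewrite -corner_refine (ce_range hA).
Qed.

End CornerBimodule.

Section CornerContext.
Variables (A B : nuAlgType k) (iA : A -> S) (iB : B -> S).
Hypotheses (hA : corner_embedding true iA) (hB : corner_embedding false iB).

Local Notation X := (corner_bimodule hA hB).
Local Notation Y := (corner_bimodule hB hA).
Local Notation tA := (@corner_pairing true false A iA).
Local Notation tB := (@corner_pairing false true B iB).

Let injA := ce_inj hA.
Let injB := ce_inj hB.
Let pairingE := (corner_pairingE (c := false) hA, corner_pairingE (c := true) hB).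
Let homM := ((ce_hom hA).2, (ce_hom hB).2).

Fact corner_tauA_balanced (x : X) b (y : Y) : tA (ract x b) y = tA x (lact b y).
Proof. by apply: injA; rewrite !pairingE /= amulA. Qed.

Fact corner_tauB_balanced (y : Y) a (x : X) : tB (ract y a) x = tB y (lact a x).
Proof. by apply: injB; rewrite !pairingE /= amulA. Qed.

Fact corner_tauA_lact a (x : X) (y : Y) : tA (lact a x) y = a ** tA x y.
Proof. by apply: injA; rewrite homM !pairingE /= amulA. Qed.

Fact corner_tauA_ract (x : X) (y : Y) a : tA x (ract y a) = tA x y ** a.
Proof. by apply: injA; rewrite homM !pairingE /= amulA. Qed.

Fact corner_tauB_lact b (y : Y) (x : X) : tB (lact b y) x = b ** tB y x.
Proof. by apply: injB; rewrite homM !pairingE /= amulA. Qed.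

Fact corner_tauB_ract (y : Y) (x : X) b : tB y (ract x b) = tB y x ** b.
Proof. by apply: injB; rewrite homM !pairingE /= amulA. Qed.

Fact corner_tauAB (x : X) (y : Y) (x' : X) : lact (tA x y) x' = ract x (tB y x').
Proof. by apply: val_inj; rewrite /= !pairingE amulA. Qed.

Fact corner_tauBA (y : Y) (x : X) (y' : Y) : lact (tB y x) y' = ract y (tA x y').
Proof. by apply: val_inj; rewrite /= !pairingE amulA. Qed.

Definition corner_context : moritaContext A B :=
  @MoritaContext k A B X Y tA tB
    (corner_pairing_bilinear false hA) (corner_pairing_bilinear true hB)
    corner_tauA_balanced corner_tauB_balanced
    corner_tauA_lact corner_tauA_ract corner_tauB_lact corner_tauB_ract
    corner_tauAB corner_tauBA.

Local Notation M := corner_context.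

Lemma corner_morita : morita_equivalence M.
Proof.
have idem b (C : nuAlgType k) (i : C -> S) :
    corner_embedding b i -> idempotent_alg C.
  move=> h; apply: (inj_image (ce_inj h)); rewrite (aprod_image (ce_hom h)).
  by rewrite (ce_range h) -corner_refine.
split; [exact: idem hA|exact: idem hB|exact: corner_unital|exact: corner_unital
       |exact: corner_pairing_surj|exact: corner_pairing_surj].
Qed.

(** The four Peirce components of [I] make up its context algebra, so this map
    identifies the latter with [I] itself; partial actions on the context
    algebra are then restrictions of actions on [S]. *)
Definition context_embed (u : context_alg M) : S :=
  (iA u.1.1 + \val u.1.2) + (\val u.2.1 + iB u.2.2).

Let cA a := embed_corner hA a.
Let cB b := embed_corner hB b.
Let cX (x : X) : corner p I true false (\val x) := submod_valP x.
Let cY (y : Y) : corner p I false true (\val y) := submod_valP y.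

Lemma context_embed_pLR b c u : pL p b (pR p c (context_embed u)) =
  if b then if c then iA u.1.1 else \val u.1.2
  else if c then \val u.2.1 else iB u.2.2.
Proof.
rewrite /context_embed !(linear_mapD (pR_linear p c)).
rewrite (pR_corner _ (cA _)) (pR_corner _ (cB _)).
rewrite (pR_corner _ (cX _)) (pR_corner _ (cY _)).
case: c => /=; rewrite ?addr0 ?add0r (linear_mapD (pL_linear p b)).
  rewrite (pL_corner _ (cA _)) (pL_corner _ (cY _)).
  by case: b => /=; rewrite ?addr0 ?add0r.
rewrite (pL_corner _ (cX _)) (pL_corner _ (cB _)).
by case: b => /=; rewrite ?addr0 ?add0r.
Qed.

Lemma context_embed_inj : injective context_embed.
Proof.
move=> u v e; have E b c := context_embed_pLR b c u.
have {}E b c := etrans (esym (E b c)) (etrans (congr1 _ (congr1 _ e))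
  (context_embed_pLR b c v)).
case: u v {e} E => -[a x] [y b] [[a' x'] [y' b']] E.
move: (E true true) (E true false) (E false true) (E false false) => /=.
by move=> /injA -> /val_inj -> /val_inj -> /injB ->.
Qed.

Lemma context_embed_hom : alg_hom context_embed.
Proof.
split.
  move=> c [[a x] [y b]] [[a' x'] [y' b']]; rewrite /context_embed /=.
  rewrite (ce_hom hA).1 (ce_hom hB).1 !scalerDr.
  by rewrite (addrACA (c *: iA a)) (addrACA (c *: submod_val y)); exact: addrACA.
move=> [[a x] [y b]] [[a' x'] [y' b']]; rewrite /context_embed /=.
rewrite (linear_mapD (ce_hom hA).1) (linear_mapD (ce_hom hB).1) !homM !pairingE.
rewrite !amulDl !amulDr.
rewrite (corner_orth (cA a) (cY y')) //.
rewrite (corner_orth (cA a) (cB b')) //.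
rewrite (corner_orth (cX x) (cA a')) // (corner_orth (cX x) (cX x')) //.
rewrite (corner_orth (cY y) (cY y')) //.
rewrite (corner_orth (cY y) (cB b')) //.
rewrite (corner_orth (cB b) (cA a')) // (corner_orth (cB b) (cX x')) //.
rewrite ?addr0 ?add0r.
by congr (_ + _); exact: addrACA.
Qed.

Lemma context_embed_range : range context_embed = I.
Proof.
apply/seteqP; split.
  move=> _ [u _ <-]; rewrite /context_embed.
  apply: (submoduleD hI.1); apply: (submoduleD hI.1).
  - by case: (cA u.1.1).
  - by case: (cX u.1.2).
  - by case: (cY u.2.1).
  - by case: (cB u.2.2).
move=> x Ix.
have hc b c : corner p I b c (pL p b (pR p c x)).
  by apply: cornerP; apply: pL_stable => //; exact: pR_stable.
have : range iA (pL p true (pR p true x)) by rewrite (ce_range hA).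
have : range iB (pL p false (pR p false x)) by rewrite (ce_range hB).
move=> [b _ eb] [a _ ea].
pose x' : X := @to_submod _ _ (corner_submod true false) _ (hc true false).
pose y' : Y := @to_submod _ _ (corner_submod false true) _ (hc false true).
exists ((a, x'), (y', b)) => //=; rewrite /context_embed /= ea eb.
have sumR b' : pL p b' (pR p true x) + pL p b' (pR p false x) = pL p b' x.
  by rewrite -(linear_mapD (pL_linear p b')) pR_sum.
by rewrite !sumR pL_sum.
Qed.

End CornerContext.
End IdealContext.

Section PartialMorita.
Context {k : comPzRingType} {G : groupType} {S : nuAlgType k}.
Variables (beta : G -> S -> S) (p : peirce S) (I : set S).
Hypothesis hb : global_action beta.
Hypothesis hI : commuting_ideal beta I.
Hypothesis fullI : full p I.
Hypothesis betaL : forall t b x, pL p b (beta t x) = beta t (pL p b x).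
Hypothesis betaR : forall t b x, pR p b (beta t x) = beta t (pR p b x).

Let idlI := ci_ideal hI.
Let idemI := ci_idem hI.

Local Notation D := (restricted_dom beta I).

Lemma conj_full t : full p (beta t @` I).
Proof.
move=> d _ [x Ix <-].
have : (beta t @` aprod (pR p d @` I) I) (beta t x) by exists x => //; exact: fullI.
rewrite (aprod_image (ga_hom hb t)); apply: aprodS => //.
by move=> _ [_ [y Iy <-] <-]; exists (beta t y); [exists y|rewrite betaR].
Qed.

Lemma conj_corner t b c : beta t @` corner p I b c = corner p (beta t @` I) b c.
Proof.
apply/seteqP; split.
  move=> _ [x [Ix lx rx] <-]; split; first by exists x.
    by rewrite betaL lx.
  by rewrite betaR rx.
have inj := can_inj (gaK hb t).
move=> _ [[x Ix <-] lx rx]; exists x => //.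
by split=> //; apply: inj; rewrite -?betaL -?betaR.
Qed.

Lemma restricted_dom_expand t J :
  D t `<=` J -> D t `<=` aprod (aprod I (D t)) J.
Proof.
move=> DJ; rewrite -[X in X `<=` _](restricted_dom_idem hb hI).
rewrite -[X in aprod X _ `<=` _](restricted_dom_idem hb hI).
by do 2?apply: aprodS => //; exact: restricted_domS.
Qed.

(** Passing to a corner commutes with forming the domains: one inclusion needs
    that e_b can be inserted in both factors of I beta_t(I). *)
Lemma corner_restricted_dom t b :
  corner p (D t) b b = aprod (corner p I b b) (beta t @` corner p I b b).
Proof.
have dI := restricted_dom_ideal hb hI t.
apply/seteqP; split; last first.
  apply: spanprod_sub; first exact: corner_submodule dI.1.
  move=> x y hx; rewrite conj_corner => hy; apply: (cornerM hx hy).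
  by apply: aprod_incl; [case: hx|case: hy].
rewrite conj_corner.
have := corner_factor (b := b) (c := b) b b idlI (conj_ideal hb hI t) dI idemI
  (conj_idem hb hI t) (restricted_dom_idem hb hI t) fullI (@conj_full t)
  (restricted_dom_expand (restricted_dom_conjS hb hI (t := t))).
move=> /subset_trans; apply.
rewrite -aprodA; apply: aprodS => //; apply: spanprod_sub.
  by apply: corner_submodule; exact: (conj_ideal hb hI t).1.
move=> x y hx hy; apply: (cornerM hx hy); case: hy => hy _ _.
exact: ((conj_ideal hb hI t).2 _ _ hy).1.
Qed.

(** The domains satisfy D = I D I, and e_c can be inserted on both sides of the
    factor D; for distinct [b] and [c] this is the relation between the domains
    on the two sides of a Morita equivalence. *)
Lemma corner_restricted_dom_mul t b c :
  aprod (aprod (corner p I b c) (corner p (D t) c c)) (corner p I c b) =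
  corner p (D t) b b.
Proof.
have dI := restricted_dom_ideal hb hI t.
apply/seteqP; split; last first.
  apply: (corner_factor c c idlI idlI dI) => //.
  - exact: restricted_dom_idem.
  - by apply: restricted_dom_expand; exact: restricted_domS.
have mull : aprod (corner p I b c) (corner p (D t) c c) `<=` corner p (D t) b c.
  apply: spanprod_sub; first exact: corner_submodule dI.1.
  move=> x y hx hy; apply: (cornerM hx hy); case: hy => hy _ _.
  exact: (dI.2 _ _ hy).1.
apply: subset_trans (aprodS mull (@subset_refl _ _)) _.
apply: spanprod_sub; first exact: corner_submodule dI.1.
move=> x y hx hy; apply: (cornerM hx hy); case: hx => hx _ _.
exact: (dI.2 _ _ hx).2.
Qed.

(** A partial action realized on the corner e_b I e_b as a restriction of
    [beta]. *)
Record corner_paction (b : bool) (A : nuAlgType k) (i : A -> S)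
    (alpha : pactionData G A) : Prop := {
  cp_embed : corner_embedding p I b i;
  cp_dom : forall t, pa_dom alpha t =
    i @^-1` aprod (corner p I b b) (beta t @` corner p I b b);
  cp_map : intertwines beta i alpha;
  cp_ppa : product_partial_action alpha
}.

Section CornerPaction.
Variables (b : bool) (A : nuAlgType k) (i : A -> S) (alpha : pactionData G A).
Hypothesis hA : corner_paction b i alpha.

Lemma corner_paction_dom t x : pa_dom alpha t x <-> D t (i x).
Proof.
rewrite (cp_dom hA) /= -corner_restricted_dom.
split=> [[]//|hx]; have [] := embed_corner (cp_embed hA) x.
by split.
Qed.

Lemma image_corner_paction_dom t : i @` pa_dom alpha t = corner p (D t) b b.
Proof.
apply/seteqP; split.
  move=> _ [x /corner_paction_dom hx <-]; split=> //;
  by have [] := embed_corner (cp_embed hA) x.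
move=> x [hx lx rx]; have : range i x.
  by rewrite (ce_range (cp_embed hA)); split=> //; exact: restricted_domS hx.
by case=> y _ yx; exists y => //; apply/corner_paction_dom; rewrite yx.
Qed.

End CornerPaction.

Section Main.
Variables (A B : nuAlgType k) (iA : A -> S) (iB : B -> S).
Variables (alpha : pactionData G A) (alpha' : pactionData G B).
Hypothesis hA : corner_paction true iA alpha.
Hypothesis hB : corner_paction false iB alpha'.

Let M := corner_context idlI (cp_embed hA) (cp_embed hB).
Let phi : context_alg M -> S := @context_embed _ _ _ _ _ _ _ _ _ _ _.

(** The restriction of [beta] to [I], read on the context algebra. The default 0
    is only taken where [beta t (phi u)] is not in [I]. *)
Definition context_paction : pactionData G (context_alg M) :=
  PActionData (fun t => phi @^-1` D t)
              (fun t u => xget 0 [set v | phi v = beta t (phi u)]).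

Let phi_range : range phi = I := context_embed_range idlI idemI _ _.

Lemma context_paction_map : intertwines beta phi context_paction.
Proof.
move=> t u hu.
have : range phi (beta t (phi u)).
  rewrite phi_range; apply: (restricted_domS hI (t := t)).
  by rewrite -(restricted_dom_act hb hI); exists (phi u).
case=> v _ ev.
by apply: (@xgetPex _ 0 [set v | phi v = beta t (phi u)]); exists v.
Qed.

Theorem corner_pactions_morita : morita_equivalent_pactions alpha alpha'.
Proof.
split; [exact: cp_ppa hA|exact: cp_ppa hB|].
have phi_inj : injective phi by exact: context_embed_inj.
have corner1E a : phi (corner1 M a) = iA a.
  by rewrite /phi /context_embed /= (linear_map0 (ce_hom (cp_embed hB)).1) !addr0.
have corner2E a : phi (corner2 M a) = iB a.
  by rewrite /phi /context_embed /= (linear_map0 (ce_hom (cp_embed hA)).1) !add0r.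
exists M, context_paction; split.
- exact: corner_morita.
- apply: (restriction_product_partial_action hb hI (iota := phi)) => //.
  + exact: context_embed_hom.
  + exact: context_paction_map.
- move=> t; apply: (inj_image (ce_inj (cp_embed hB))).
  rewrite (image_corner_pairing (cp_embed hB)) range_submod_val.
  rewrite (spanprod_image (g := @amul k S) (p := \val) (q := iA)) //.
  rewrite range_submod_val (image_corner_paction_dom hA).
  by rewrite -!/(aprod _ _) corner_restricted_dom_mul (image_corner_paction_dom hB).
- split=> [t|t a ha].
    by apply/seteqP; split=> a; rewrite /= corner1E -(corner_paction_dom hA).
  apply: phi_inj; rewrite context_paction_map; last first.
    by rewrite /= corner1E -(corner_paction_dom hA).
  by rewrite !corner1E (cp_map hA).
- split=> [t|t a ha].
    by apply/seteqP; split=> a; rewrite /= corner2E -(corner_paction_dom hB).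
  apply: phi_inj; rewrite context_paction_map; last first.
    by rewrite /= corner2E -(corner_paction_dom hB).
  by rewrite !corner2E (cp_map hB).
Qed.

End Main.
End PartialMorita.

(** * Smash products *)

Record graded_map (k : comPzRingType) (G : groupType) (B B' : gradedAlg k G) :=
  GradedMap {
    gm_fun :> B -> B';
    gm_linear : linear gm_fun;
    gm_graded : forall t b, gcomp B t b -> gcomp B' t (gm_fun b)
  }.

Section SmashMap.
Context {k : comPzRingType} {G : groupType} {B B' : gradedAlg k G}.
Variable h : graded_map B B'.

Lemma mxmap_smash (f : smash B) : (fun q => h (\val f q)) \in @smash_pred k G B'.
Proof.
have [ff hf] := smashP f; apply/smash_predP; split=> [|r s]; last exact: gm_graded.
apply: sub_finite_set ff => q /=; apply: contra_neq => ->.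
exact: linear_map0 (gm_linear h).
Qed.

Definition smash_map (f : smash B) : smash B' := Smash (mxmap_smash f).

Lemma smash_map_linear : linear smash_map.
Proof. by move=> c f g; apply: val_inj; apply/funext => q; exact: gm_linear. Qed.

Lemma smash_map_act t f : smash_map (smash_act t f) = smash_act t (smash_map f).
Proof. exact: val_inj. Qed.

End SmashMap.

Lemma smash_mapM (k : comPzRingType) (G : groupType) (B B' : gradedAlg k G)
    (h h1 h2 : graded_map B B') :
  (forall x y, h (x ** y) = h1 x ** h2 y) ->
  forall f g, smash_map h (f ** g) = smash_map h1 f ** smash_map h2 g.
Proof.
move=> hM f g; have [S hS] := smash_bound f.
apply: val_inj; apply/funext => -[r s] /=.
rewrite (mxmulE (S := S)) => [|t tS] /=; last by rewrite hS ?amul0l //; right.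
rewrite (mxmulE (S := S)) => [|t tS] /=; last first.
  by rewrite hS ?(linear_map0 (gm_linear h1)) ?amul0l //; right.
by rewrite (linear_map_sum (gm_linear h)); apply: eq_bigr => t _; rewrite hM.
Qed.

Section SmashBlocks.
Context {k : comPzRingType} {G : groupType} (B : gradedAlg k G).
Implicit Types (f g : smash B) (r s t : G) (b c : B).

Lemma smash_act_global : global_action (@smash_act k G B).
Proof.
split=> [t|f|s t f].
- split=> [c f g|f g]; first exact: val_inj.
  apply: val_inj; apply/funext => -[r s]; rewrite /= /mxshift /mxmul /=.
  apply: (reindex_fsbigT (fun u => t^-1 * u)%g).
  by exists (fun u => t * u)%g => u; rewrite (mulVKg, mulKg).
- by apply: val_inj; apply/funext => -[r s]; rewrite /= /mxshift invg1 !mul1g.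
- by apply: val_inj; apply/funext => -[r u]; rewrite /= /mxshift /= invgM !mulgA.
Qed.

(** The matrix [b e_{r,s}]; the default 0 is only taken when [b] is not in
    B_{r^-1 s}. *)
Definition smash_single r s b : smash B :=
  insubd (0 : smash B) (fun q : G * G => if q == (r, s) then b else 0).

Lemma smash_singleE r s b : gcomp B (r^-1 * s)%g b ->
  forall q, \val (smash_single r s b) q = if q == (r, s) then b else 0.
Proof.
move=> hB q; rewrite /smash_single insubdK //; apply/smash_predP; split.
  apply: (@sub_finite_set _ _ [set (r, s)]); last exact: finite_set1.
  by move=> q' /=; case: (q' =P (r, s)) => // _; rewrite eqxx.
move=> r' s'; case: eqP => [[-> ->]//|_].
exact: submodule0 (gcomp_submodule B _).
Qed.

Lemma smash_single_linear r s (c : k) b b' :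
  gcomp B (r^-1 * s)%g b -> gcomp B (r^-1 * s)%g b' ->
  smash_single r s (c *: b + b') = c *: smash_single r s b + smash_single r s b'.
Proof.
move=> hb hb'; apply: val_inj; apply/funext => q.
transitivity (c *: \val (smash_single r s b) q + \val (smash_single r s b') q) => //.
rewrite !smash_singleE //; last exact: submoduleP (gcomp_submodule B _) hb hb'.
by case: eqP => // _; rewrite scaler0 addr0.
Qed.

Lemma smash_single0 r s : smash_single r s 0 = 0.
Proof.
apply: val_inj; apply/funext => q; rewrite smash_singleE; first by case: eqP.
exact: submodule0 (gcomp_submodule B _).
Qed.

Lemma gcompM_diff r s t b c :
  gcomp B (r^-1 * s)%g b -> gcomp B (s^-1 * t)%g c ->
  gcomp B (r^-1 * t)%g (b ** c).
Proof.
by move=> hb hc; have := gcompM hb hc; rewrite mulgA mulgK.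
Qed.

Lemma smash_singleM r s t b c :
  gcomp B (r^-1 * s)%g b -> gcomp B (s^-1 * t)%g c ->
  smash_single r s b ** smash_single s t c = smash_single r t (b ** c).
Proof.
move=> hb hc; apply: val_inj; apply/funext => -[u v].
rewrite smash_singleE; last exact: gcompM_diff hb hc.
rewrite /= (mxmulE (S := [fset s]%fset)) => [|w]; last first.
  rewrite inE /= => /eqP ws; rewrite smash_singleE //.
  by case: eqP => [[_ /ws]//|_]; rewrite amul0l.
rewrite big_seq_fset1 /= !smash_singleE // !xpair_eqE !eqxx /= andbT.
by case: eqP; case: eqP; rewrite ?amul0l ?amul0r.
Qed.

(** A matrix is the sum of its entries. *)
Lemma smash_ind (T : set (smash B)) f :
  submodule T -> (forall r s, T (smash_single r s (\val f (r, s)))) -> T f.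
Proof.
move=> hT h; have [ff hf] := smashP f.
rewrite (_ : f = \sum_(q <- fset_set [set q | \val f q != 0])
                    smash_single q.1 q.2 (\val f q)).
  by apply: submodule_sum => // -[r s]; exact: h.
apply: val_inj; apply/funext => q.
have lin : linear (fun g : smash B => \val g q) by [].
rewrite [RHS](linear_map_sum lin).
under eq_bigr => q' _.
  rewrite smash_singleE -?surjective_pairing; last by case: q' => *; exact: hf.
  over.
have [fq0|fq] := eqVneq (\val f q) 0.
  rewrite fq0 big1_seq // => q' _ /=; case: eqP => // <-; exact: fq0.
rewrite (bigD1_seq q) ?fset_uniq //=; last by rewrite in_fset_set // inE.
rewrite eqxx big1 ?addr0 // => q' /negPf.
by rewrite eq_sym => ->.
Qed.

Definition smash_col t : set (smash B) :=
  [set f | forall r s, s <> t -> \val f (r, s) = 0].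

Definition smash_row t : set (smash B) :=
  [set f | forall r s, r <> t -> \val f (r, s) = 0].

Lemma smash_single_col r s b :
  gcomp B (r^-1 * s)%g b -> smash_col s (smash_single r s b).
Proof. by move=> hb r' s' ss'; rewrite smash_singleE //; case: eqP => // -[_ /ss']. Qed.

Lemma smash_single_row r s b :
  gcomp B (r^-1 * s)%g b -> smash_row r (smash_single r s b).
Proof. by move=> hb r' s' ss'; rewrite smash_singleE //; case: eqP => // -[/ss']. Qed.

Lemma smash_col_submodule t : submodule (smash_col t).
Proof.
split=> [|c f g]; rewrite !inE => // hf hg r s st.
transitivity (c *: \val f (r, s) + \val g (r, s)) => //.
by rewrite hf // hg // scaler0 addr0.
Qed.

Lemma smash_row_submodule t : submodule (smash_row t).
Proof.
split=> [|c f g]; rewrite !inE => // hf hg r s st.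
transitivity (c *: \val f (r, s) + \val g (r, s)) => //.
by rewrite hf // hg // scaler0 addr0.
Qed.

Lemma aprod_col t (P : set (smash B)) : aprod P (smash_col t) `<=` smash_col t.
Proof.
apply: spanprod_sub => [|f g _ hg r s st]; first exact: smash_col_submodule.
by rewrite /= /mxmul big1_seq // => u _; rewrite hg // amul0r.
Qed.

Lemma aprod_row t (P : set (smash B)) : aprod (smash_row t) P `<=` smash_row t.
Proof.
apply: spanprod_sub => [|f g hf _ r s st]; first exact: smash_row_submodule.
by rewrite /= /mxmul big1_seq // => u _; rewrite hf // amul0l.
Qed.

Lemma smash_row_sub t (T : set (smash B)) : submodule T ->
  (forall s b, gcomp B (t^-1 * s)%g b -> T (smash_single t s b)) ->
  smash_row t `<=` T.
Proof.
move=> hT h f hf; apply: smash_ind => // r s; have [_ hg] := smashP f.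
have [->|/eqP rt] := eqVneq r t; first exact: h.
by rewrite hf // smash_single0; exact: submodule0.
Qed.

Lemma act_col t s : @smash_act k G B t @` smash_col s = smash_col (t * s)%g.
Proof.
have gact := smash_act_global.
have sub u v : @smash_act k G B u @` smash_col v `<=` smash_col (u * v)%g.
  move=> _ [f hf <-] r q hq; apply: hf => /= e; apply: hq.
  by rewrite -e mulVKg.
apply/seteqP; split=> // f hf; exists (smash_act t^-1%g f); last exact: (gaVK gact).
by rewrite -[s](mulKg t); apply: sub; exists f.
Qed.

Lemma act_row t s : @smash_act k G B t @` smash_row s = smash_row (t * s)%g.
Proof.
have gact := smash_act_global.
have sub u v : @smash_act k G B u @` smash_row v `<=` smash_row (u * v)%g.
  move=> _ [f hf <-] r q hq; apply: hf => /= e; apply: hq.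
  by rewrite -e mulVKg.
apply/seteqP; split=> // f hf; exists (smash_act t^-1%g f); last exact: (gaVK gact).
by rewrite -[s](mulKg t); apply: sub; exists f.
Qed.

Lemma smash_single_preimage r s (T : set (smash B)) :
  submodule T ->
  submodule [set b | gcomp B (r^-1 * s)%g b /\ T (smash_single r s b)].
Proof.
move=> hT; split=> [|c b b']; rewrite !inE /=.
  by rewrite smash_single0; split; apply: submodule0 => //; exact: gcomp_submodule.
move=> [hb Tb] [hb' Tb']; split.
  exact: submoduleP (gcomp_submodule B _) hb hb'.
by rewrite smash_single_linear //; exact: submoduleP.
Qed.

(** Because b c e_{r,s} = (b e_{r,1}) (c e_{1,s}), the ideal is S e_{1,1} S for
    S = B#G, where e_{1,1} is a multiplier that need not lie in S: the column
    S e_{1,1} and the row e_{1,1} S replace it. *)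
Lemma psmash_ideal_col_row : psmash_ideal B = aprod (smash_col 1%g) (smash_row 1%g).
Proof.
apply/seteqP; split=> [f hf|].
  apply: smash_ind => [|r s]; first exact: aprod_submodule.
  set T := aprod _ _.
  suff : aprod (gcomp B r^-1%g) (gcomp B s) `<=`
         [set b | gcomp B (r^-1 * s)%g b /\ T (smash_single r s b)].
    by move/(_ _ (hf r s)); case.
  apply: spanprod_sub => [|b c hb hc].
    by apply: smash_single_preimage; exact: aprod_submodule.
  have hb' : gcomp B (r^-1 * 1)%g b by rewrite mulg1.
  have hc' : gcomp B (1^-1 * s)%g c by rewrite invg1 mul1g.
  split; first exact: gcompM hb hc.
  by rewrite -(smash_singleM hb' hc'); apply: aprod_incl;
    [exact: smash_single_col|exact: smash_single_row].
apply: spanprod_sub => [|f g hf hg r s]; first exact: (psmash_two_sided_ideal B).1.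
rewrite /= (mxmulE (S := [fset 1%g]%fset)) => [|w]; last first.
  by rewrite inE => /eqP w1; rewrite hf // amul0l.
rewrite big_seq_fset1 /=; apply: aprod_incl.
  by have := (smashP f).2 r 1%g; rewrite mulg1.
by have := (smashP g).2 1%g s; rewrite invg1 mul1g.
Qed.

Lemma act_psmash_ideal t :
  @smash_act k G B t @` psmash_ideal B = aprod (smash_col t) (smash_row t).
Proof.
rewrite psmash_ideal_col_row (aprod_image (ga_hom smash_act_global t)).
by rewrite act_col act_row mulg1.
Qed.

End SmashBlocks.

Arguments smash_col {k G} B t.
Arguments smash_row {k G} B t.

Section Refinement.
Context {k : comPzRingType} {G : groupType} (B : gradedAlg k G).

Lemma smash_map_single (h : graded_map B B) r s b : gcomp B (r^-1 * s)%g b ->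
  smash_map h (smash_single r s b) = smash_single r s (h b).
Proof.
move=> hb; apply: val_inj; apply/funext => q.
rewrite /= !smash_singleE //; last exact: gm_graded.
by case: eqP => // _; exact: linear_map0 (gm_linear h).
Qed.

(** A graded form of local units. For [h] the identity it is the substantial
    inclusion in B_t = B_t B_{t^-1} B_t; for [h] the right multiplication by an
    idempotent e it says that e can be inserted after the first factor. *)
Definition refines (h : graded_map B B) : Prop := forall t,
  gcomp B t `<=` aprod (aprod (h @` gcomp B t) (gcomp B t^-1%g)) (gcomp B t).

Lemma row_refine (h : graded_map B B) s : refines h ->
  smash_row B s `<=`
    aprod (aprod (smash_map h @` smash_row B s) (smash_col B s)) (smash_row B s).
Proof.
move=> hr; apply: smash_row_sub => [|t b hb]; first exact: aprod_submodule.
set T := aprod _ _.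
suff : aprod (aprod (h @` gcomp B (s^-1 * t)%g) (gcomp B (s^-1 * t)^-1%g))
             (gcomp B (s^-1 * t)%g) `<=`
       [set b | gcomp B (s^-1 * t)%g b /\ T (smash_single s t b)].
  by move/(_ _ (hr _ _ hb)); case.
apply: aprod3_sub => [|_ c d [x hx <-] + hd].
  by apply: smash_single_preimage; exact: aprod_submodule.
rewrite invgM invgK => hc; have hhx := gm_graded h hx.
have hxc := gcompM_diff hhx hc.
split; first exact: gcompM_diff hxc hd.
rewrite -(smash_singleM hxc hd) -(smash_singleM hhx hc) -smash_map_single //.
apply: aprod_incl; last exact: smash_single_row.
apply: aprod_incl; last exact: smash_single_col.
by exists (smash_single s t x) => //; exact: smash_single_row.
Qed.

Lemma id_linear : linear (@id B). Proof. by []. Qed.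

Definition graded_id : graded_map B B :=
  GradedMap id_linear (fun t b (hb : gcomp B t b) => hb).

Lemma smash_map_id : smash_map graded_id = id.
Proof. by apply/funext => f; exact: val_inj. Qed.

Hypothesis hB : partially_strongly_graded B.

Lemma graded_id_refines : refines graded_id.
Proof. by move=> t; rewrite image_id -hB. Qed.

Lemma psmash_ideal_idem : aprod (psmash_ideal B) (psmash_ideal B) = psmash_ideal B.
Proof.
apply/seteqP; split; first exact: aprod_subl (psmash_two_sided_ideal B).
rewrite psmash_ideal_col_row -[X in _ `<=` X]aprodA [X in _ `<=` aprod _ X]aprodA.
apply: aprodS => //; apply: subset_trans (row_refine graded_id_refines) _.
by rewrite smash_map_id image_id.
Qed.

(** A block e_s S e_t passes through e_t S e_s and back, because
    B_u = B_u B_{u^-1} B_u B_{u^-1} B_u for u = s^-1 t. *)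
Lemma smash_row_col_sub s t :
  aprod (smash_row B s) (smash_col B t) `<=`
  aprod (aprod (smash_col B t) (smash_row B t))
        (aprod (smash_col B s) (smash_row B s)).
Proof.
set T := (X in _ `<=` X); have hT : submodule T by exact: aprod_submodule.
apply: spanprod_sub => // f g hf hg.
have hfg : smash_row B s (f ** g) by apply: aprod_row (aprod_incl hf hg).
have hgf : smash_col B t (f ** g) by apply: aprod_col (aprod_incl hf hg).
apply: smash_ind => // r q; have [_ hv] := smashP (f ** g).
have [rs|/eqP rs] := eqVneq r s; last first.
  by rewrite hfg // smash_single0; exact: submodule0.
have [qt|/eqP qt] := eqVneq q t; last first.
  by rewrite hgf // smash_single0; exact: submodule0.
subst r q; move: (hv s t); move: (\val _ _) => b hb {f g hf hg hfg hgf hv}.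
set u := (s^-1 * t)%g; have uV : u^-1%g = (t^-1 * s)%g by rewrite invgM invgK.
set N := [set b | gcomp B u b /\ T (smash_single s t b)].
have hN : submodule N by exact: smash_single_preimage.
suff : gcomp B u `<=` N by move/(_ _ hb); case.
rewrite hB; apply: aprod3_sub => // b1 b2 b3 + hb2 hb3.
rewrite hB; move: b1; apply: (aprod3_sub (T := [set b1 | N (b1 ** b2 ** b3)])).
  apply: (@submodule_preimage _ _ _ (fun b1 => b1 ** b2 ** b3)) => // c x y.
  by rewrite !amulDl !amulZl.
move=> c1 c2 c3 hc1 hc2 hc3 /=; rewrite uV in hb2 hc2.
have h32 := gcompM_diff hc3 hb2; have h12 := gcompM_diff hc1 hc2.
have h323 := gcompM_diff h32 hb3.
rewrite -[_ ** c3 ** _]amulA -[_ ** (_ ** _) ** _]amulA.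
split; first exact: gcompM_diff h12 h323.
rewrite -(smash_singleM h12 h323) -(smash_singleM hc1 hc2) -(smash_singleM h32 hb3).
apply: aprod_incl; apply: aprod_incl;
  by [exact: smash_single_col|exact: smash_single_row].
Qed.

Lemma psmash_commuting : commuting_ideal (@smash_act k G B) (psmash_ideal B).
Proof.
split; [exact: psmash_two_sided_ideal|exact: psmash_ideal_idem|move=> t].
have sub u v :
    aprod (aprod (smash_col B u) (smash_row B u))
          (aprod (smash_col B v) (smash_row B v)) `<=`
    aprod (aprod (smash_col B v) (smash_row B v))
               (aprod (smash_col B u) (smash_row B u)).
  rewrite -[X in X `<=` _]aprodA [X in aprod _ X `<=` _]aprodA.
  apply: subset_trans (aprodS (@subset_refl _ _)
    (aprodS (@smash_row_col_sub u v) (@subset_refl _ _))) _.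
  rewrite !aprodA -[X in X `<=` _]aprodA.
  apply: aprodS; last exact: aprod_row.
  do 2![apply: aprodS => //]; exact: aprod_col.
rewrite act_psmash_ideal psmash_ideal_col_row; apply/seteqP; split; exact: sub.
Qed.

Lemma psmash_val_range : range (\val : psmash B -> smash B) = psmash_ideal B.
Proof.
apply/seteqP; split=> [_ [x _ <-]|x Ix]; first exact/psmash_predP/valP.
by exists (PSmash (introT (psmash_predP x) Ix)).
Qed.

Lemma canonical_paction_map :
  intertwines (@smash_act k G B) (\val : psmash B -> smash B) (canonical_paction B).
Proof.
move=> t x hx; rewrite /= insubdK //; apply/psmash_predP.
apply: (restricted_domS psmash_commuting (t := t)).
rewrite -(restricted_dom_act (smash_act_global B) psmash_commuting).
by exists (\val x).
Qed.

Theorem canonical_paction_product : product_partial_action (canonical_paction B).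
Proof.
apply: (restriction_product_partial_action (smash_act_global B) psmash_commuting
          (iota := \val : psmash B -> smash B)) => //.
- exact: psmash_val_range.
- exact: canonical_paction_map.
Qed.

End Refinement.

(** * Graded idempotent multipliers *)

Section GradedPeirce.
Context {k : comPzRingType} {G : groupType} (C : gradedAlg k G) (q : peirce C).
Hypothesis qL : forall b t x, gcomp C t x -> gcomp C t (pL q b x).
Hypothesis qR : forall b t x, gcomp C t x -> gcomp C t (pR q b x).

Definition graded_pL b : graded_map C C := GradedMap (pL_linear q b) (@qL b).
Definition graded_pR b : graded_map C C := GradedMap (pR_linear q b) (@qR b).

Let sL b := smash_map (graded_pL b).
Let sR b := smash_map (graded_pR b).

Fact smash_pLM b f g : sL b (f ** g) = sL b f ** g.
Proof.
rewrite /sL (smash_mapM (h1 := graded_pL b) (h2 := graded_id C)) ?smash_map_id //.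
by move=> *; exact: pLM.
Qed.

Fact smash_pRM b f g : sR b (f ** g) = f ** sR b g.
Proof.
rewrite /sR (smash_mapM (h1 := graded_id C) (h2 := graded_pR b)) ?smash_map_id //.
by move=> *; exact: pRM.
Qed.

Fact smash_pRL b f g : sR b f ** g = f ** sL b g.
Proof.
apply: val_inj; apply/funext => r; rewrite /= /mxmul.
by apply: eq_fsbigr => t _; exact: pRL.
Qed.

Fact smash_pLL b c f : sL b (sL c f) = if b == c then sL b f else 0.
Proof.
by apply: val_inj; apply/funext => r; rewrite /= pLL; case: eqP.
Qed.

Fact smash_pRR b c f : sR b (sR c f) = if b == c then sR b f else 0.
Proof.
by apply: val_inj; apply/funext => r; rewrite /= pRR; case: eqP.
Qed.

Fact smash_pLR b c f : sL b (sR c f) = sR c (sL b f).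
Proof. by apply: val_inj; apply/funext => r; exact: pLR. Qed.

Fact smash_pL_sum f : sL true f + sL false f = f.
Proof. by apply: val_inj; apply/funext => r; exact: pL_sum. Qed.

Fact smash_pR_sum f : sR true f + sR false f = f.
Proof. by apply: val_inj; apply/funext => r; exact: pR_sum. Qed.

Definition smash_peirce : peirce (smash C) :=
  Peirce (fun b => smash_map_linear (graded_pL b))
    (fun b => smash_map_linear (graded_pR b))
    smash_pLM smash_pRM smash_pRL smash_pLL smash_pRR smash_pLR
    smash_pL_sum smash_pR_sum.

(** The ideal is a column times a row, and the idempotent is inserted inside the
    row. *)
Lemma psmash_full :
  (forall b, refines (graded_pR b)) -> full smash_peirce (psmash_ideal C).
Proof.
move=> hr b; rewrite psmash_ideal_col_row.
apply: subset_trans (aprodS (@subset_refl _ _) (row_refine (hr b))) _.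
rewrite -aprodA aprodA; apply: aprodS => //.
rewrite [X in _ `<=` X](spanprod_image (g := @amul k _) (p := id) (q := sR b)).
- by rewrite image_id.
- exact: smash_map_linear.
- by move=> u v; exact: smash_pRM.
Qed.

Section GradedCorner.
Variables (A : gradedAlg k G) (b : bool).
Variables (iota : graded_map A C) (proj : graded_map C A).
Hypothesis hA : partially_strongly_graded A.
Hypothesis iotaM : {morph iota : x y / x ** y}.
Hypothesis iotaK : cancel iota proj.
Hypothesis iotaL : forall a, pL q b (iota a) = iota a.
Hypothesis iotaR : forall a, pR q b (iota a) = iota a.
Hypothesis projK : forall x, pL q b x = x -> pR q b x = x -> iota (proj x) = x.
(** This keeps the corner e_b I^C e_b within the image of I^A. *)
Hypothesis proj_mul : forall s t x y, gcomp C s x -> gcomp C t y ->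
  aprod (gcomp A s) (gcomp A t) (proj (x ** y)).

Definition psmash_embed (x : psmash A) : smash C := smash_map iota (\val x).

Lemma smash_iota_hom : alg_hom (smash_map iota).
Proof. by split; [exact: smash_map_linear|exact: smash_mapM]. Qed.

Lemma smash_iotaK : cancel (smash_map iota) (smash_map proj).
Proof. by move=> f; apply: val_inj; apply/funext => r; exact: iotaK. Qed.

Lemma image_psmash_ideal :
  smash_map iota @` psmash_ideal A = corner smash_peirce (psmash_ideal C) b b.
Proof.
apply/seteqP; split.
  move=> _ [f hf <-]; split.
  - move=> r s.
    have : (iota @` aprod (gcomp A r^-1%g) (gcomp A s)) (iota (\val f (r, s))).
      by exists (\val f (r, s)).
    rewrite (aprod_image (conj (gm_linear iota) iotaM)); apply: aprodS.
      by move=> _ [a ha <-]; exact: gm_graded.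
    by move=> _ [a ha <-]; exact: gm_graded.
  - by apply: val_inj; apply/funext => r; exact: iotaL.
  - by apply: val_inj; apply/funext => r; exact: iotaR.
move=> f [hf lf rf]; exists (smash_map proj f).
  suff sub r s v : aprod (gcomp C r^-1%g) (gcomp C s) v ->
      aprod (gcomp A r^-1%g) (gcomp A s) (proj v) by move=> r s; exact: sub (hf r s).
  move: v; apply: (spanprod_sub_linear (gm_linear proj)); first exact: aprod_submodule.
  by move=> x y; exact: proj_mul.
apply: val_inj; apply/funext => r; apply: projK.
  by have /(congr1 (fun g : smash C => \val g r)) := lf.
by have /(congr1 (fun g : smash C => \val g r)) := rf.
Qed.

Lemma psmash_embed_corner :
  corner_embedding smash_peirce (psmash_ideal C) b psmash_embed.
Proof.
split.
- split=> [c x y|x y]; first exact: smash_map_linear.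
  exact: smash_iota_hom.2.
- by move=> x y /(can_inj smash_iotaK) /val_inj.
- by rewrite -image_psmash_ideal -psmash_val_range image_comp.
Qed.

Lemma canonical_corner_paction :
  corner_paction (@smash_act k G C) smash_peirce (psmash_ideal C) b
    psmash_embed (canonical_paction A).
Proof.
split; [exact: psmash_embed_corner| | |exact: canonical_paction_product].
  move=> t; rewrite -image_psmash_ideal.
  have -> : @smash_act k G C t @` (smash_map iota @` psmash_ideal A) =
            smash_map iota @` (@smash_act k G A t @` psmash_ideal A).
    by rewrite !image_comp; apply: eq_imagel => f _; rewrite /= smash_map_act.
  rewrite -(aprod_image smash_iota_hom).
  apply/seteqP; split=> x /= hx; first by exists (\val x).
  by case: hx => f hf /(can_inj smash_iotaK) <-.
move=> t x hx; rewrite /psmash_embed (canonical_paction_map hA) //.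
exact: smash_map_act.
Qed.

End GradedCorner.
End GradedPeirce.

(** * The context algebra of a graded Morita context *)

Lemma fsbig_linear (k : comPzRingType) (I : choiceType) (V W : lmodType k)
    (h : V -> W) (f : I -> V) :
  linear h -> finite_set [set i | f i != 0] ->
  h (\sum_(i \in [set: I]) f i) = \sum_(i \in [set: I]) h (f i).
Proof.
move=> hl ff.
have out i : i \notin fset_set [set i | f i != 0] -> f i = 0.
  by rewrite in_fset_set // => /negP; apply: contra_notP => /eqP; rewrite inE.
rewrite (fsbigTE (fset_set [set i | f i != 0])) => [|i /out //].
rewrite (fsbigTE (fset_set [set i | f i != 0])) => [|i /out ->].
  exact: linear_map_sum.
exact: linear_map0.
Qed.

Lemma direct_sum_prod (k : comPzRingType) (G : choiceType) (V W : lmodType k)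
    (V_ : G -> set V) (W_ : G -> set W) :
  direct_sum V_ -> direct_sum W_ ->
  direct_sum (fun t => [set u : V * W | V_ t u.1 /\ W_ t u.2]).
Proof.
move=> [sV dV] [sW dW].
have lin1 : linear (@fst V W) by [].
have lin2 : linear (@snd V W) by [].
split=> [t|[v w]].
  exact: (submoduleI (submodule_preimage lin1 (sV t)) (submodule_preimage lin2 (sW t))).
have [f [[ff hf ef] uf]] := dV v; have [g [[fg hg eg] ug]] := dW w.
exists (fun t => (f t, g t)); split.
  have fin : finite_set [set t | (f t, g t) != 0].
    apply: (@sub_finite_set _ _ ([set t | f t != 0] `|` [set t | g t != 0])).
      by move=> t /=; rewrite -[_ == 0]/((f t == 0) && (g t == 0)) negb_and => /orP.
    by rewrite finite_setU.
  split=> //; rewrite [RHS]surjective_pairing.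
  by rewrite (fsbig_linear lin1) // (fsbig_linear lin2) // -ef -eg.
move=> F [fF hF eF]; apply/funext => t; rewrite [F t]surjective_pairing; congr (_, _).
  rewrite (uf (fun t => (F t).1)) //; split=> [|u|].
  - by apply: sub_finite_set fF => u /=; apply: contra_neq => ->.
  - by case: (hF u).
  - by rewrite -(fsbig_linear lin1) // -eF.
rewrite (ug (fun t => (F t).2)) //; split=> [|u|].
- by apply: sub_finite_set fF => u /=; apply: contra_neq => ->.
- by case: (hF u).
- by rewrite -(fsbig_linear lin2) // -eF.
Qed.

Section ContextPeirce.
Context {k : comPzRingType} {A B : nuAlgType k} (M : moritaContext A B).
Local Notation C := (context_alg M).
Implicit Types (u v : C) (d : bool).

Definition context_pL d u : C :=
  if d then (u.1, (0, 0)) else ((0, 0), u.2).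

Definition context_pR d u : C :=
  if d then ((u.1.1, 0), (u.2.1, 0)) else ((0, u.1.2), (0, u.2.2)).

Let zero_l := (@amul0l k, bilinear0l (lact_bilinear (mcX M)),
  bilinear0l (ract_bilinear (mcX M)), bilinear0l (lact_bilinear (mcY M)),
  bilinear0l (ract_bilinear (mcY M)),
  bilinear0l (tauA_bilinear M), bilinear0l (tauB_bilinear M)).
Let zero_r := (@amul0r k, bilinear0r (lact_bilinear (mcX M)),
  bilinear0r (ract_bilinear (mcX M)), bilinear0r (lact_bilinear (mcY M)),
  bilinear0r (ract_bilinear (mcY M)),
  bilinear0r (tauA_bilinear M), bilinear0r (tauB_bilinear M)).
Let zeros := (zero_l, zero_r, addr0, add0r).

Fact context_pL_linear d : linear (context_pL d).
Proof.
move=> c [[a x] [y b]] [[a' x'] [y' b']].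
by case: d; congr ((_, _), (_, _)); rewrite /= ?scaler0 ?addr0.
Qed.

Fact context_pR_linear d : linear (context_pR d).
Proof.
move=> c [[a x] [y b]] [[a' x'] [y' b']].
by case: d; congr ((_, _), (_, _)); rewrite /= ?scaler0 ?addr0.
Qed.

Fact context_pLM d u v : context_pL d (u ** v) = context_pL d u ** v.
Proof.
case: u v => -[a x] [y b] [[a' x'] [y' b']].
by case: d; congr ((_, _), (_, _)); rewrite /= !zeros.
Qed.

Fact context_pRM d u v : context_pR d (u ** v) = u ** context_pR d v.
Proof.
case: u v => -[a x] [y b] [[a' x'] [y' b']].
by case: d; congr ((_, _), (_, _)); rewrite /= !zeros.
Qed.

Fact context_pRL d u v : context_pR d u ** v = u ** context_pL d v.
Proof.
case: u v => -[a x] [y b] [[a' x'] [y' b']].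
by case: d; congr ((_, _), (_, _)); rewrite /= !zeros.
Qed.

Fact context_pLL d e u :
  context_pL d (context_pL e u) = if d == e then context_pL d u else 0.
Proof. by case: d e u => -[] [[a x] [y b]]. Qed.

Fact context_pRR d e u :
  context_pR d (context_pR e u) = if d == e then context_pR d u else 0.
Proof. by case: d e u => -[] [[a x] [y b]]. Qed.

Fact context_pLR d e u :
  context_pL d (context_pR e u) = context_pR e (context_pL d u).
Proof. by case: d e u => -[] [[a x] [y b]]. Qed.

Fact context_pL_sum u : context_pL true u + context_pL false u = u.
Proof.
by case: u => -[a x] [y b]; congr ((_, _), (_, _)); rewrite /= ?addr0 ?add0r.
Qed.

Fact context_pR_sum u : context_pR true u + context_pR false u = u.
Proof.
by case: u => -[a x] [y b]; congr ((_, _), (_, _)); rewrite /= ?addr0 ?add0r.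
Qed.

Definition context_peirce : peirce C :=
  Peirce context_pL_linear context_pR_linear context_pLM context_pRM context_pRL
    context_pLL context_pRR context_pLR context_pL_sum context_pR_sum.

Definition cornerX (x : mcX M) : C := ((0, x), (0, 0)).
Definition cornerY (y : mcY M) : C := ((0, 0), (y, 0)).

Lemma corner1_linear : linear (@corner1 k A B M).
Proof. by move=> c a a'; congr ((_, _), (_, _)); rewrite /= ?scaler0 ?addr0. Qed.

Lemma corner2_linear : linear (@corner2 k A B M).
Proof. by move=> c a a'; congr ((_, _), (_, _)); rewrite /= ?scaler0 ?addr0. Qed.

Lemma cornerX_linear : linear cornerX.
Proof. by move=> c a a'; congr ((_, _), (_, _)); rewrite /= ?scaler0 ?addr0. Qed.

Lemma cornerY_linear : linear cornerY.
Proof. by move=> c a a'; congr ((_, _), (_, _)); rewrite /= ?scaler0 ?addr0. Qed.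

Lemma corner1M : {morph @corner1 k A B M : a a' / a ** a'}.
Proof. by move=> a a'; congr ((_, _), (_, _)); rewrite /= !zeros. Qed.

Lemma corner2M : {morph @corner2 k A B M : a a' / a ** a'}.
Proof. by move=> a a'; congr ((_, _), (_, _)); rewrite /= !zeros. Qed.

Lemma corner1X a x : corner1 M a ** cornerX x = cornerX (lact a x).
Proof. by congr ((_, _), (_, _)); rewrite /= !zeros. Qed.

Lemma cornerX2 x b : cornerX x ** corner2 M b = cornerX (ract x b).
Proof. by congr ((_, _), (_, _)); rewrite /= !zeros. Qed.

Lemma corner2Y b y : corner2 M b ** cornerY y = cornerY (lact b y).
Proof. by congr ((_, _), (_, _)); rewrite /= !zeros. Qed.

Lemma cornerY1 y a : cornerY y ** corner1 M a = cornerY (ract y a).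
Proof. by congr ((_, _), (_, _)); rewrite /= !zeros. Qed.

Lemma cornerXY x y : cornerX x ** cornerY y = corner1 M (tauA M x y).
Proof. by congr ((_, _), (_, _)); rewrite /= !zeros. Qed.

Lemma cornerYX y x : cornerY y ** cornerX x = corner2 M (tauB M y x).
Proof. by congr ((_, _), (_, _)); rewrite /= !zeros. Qed.

Lemma context_decomp u :
  u = (corner1 M u.1.1 + cornerX u.1.2) + (cornerY u.2.1 + corner2 M u.2.2).
Proof.
by case: u => -[a x] [y b]; congr ((_, _), (_, _)); rewrite /= ?addr0 ?add0r.
Qed.

End ContextPeirce.

Section GradedContext.
Context {k : comPzRingType} {G : groupType} {A B : gradedAlg k G}.
Variable M : gradedMoritaContext A B.

Definition context_comp (t : G) : set (context_alg M) :=
  [set u | (gcomp A t u.1.1 /\ gX M t u.1.2) /\ (gY M t u.2.1 /\ gcomp B t u.2.2)].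

Lemma context_direct_sum : direct_sum context_comp.
Proof.
exact: (direct_sum_prod (direct_sum_prod (gcomp_direct_sum A) (gX_direct_sum M))
         (direct_sum_prod (gY_direct_sum M) (gcomp_direct_sum B))).
Qed.

Lemma context_comp_mul s t :
  aprod (context_comp s) (context_comp t) `<=` context_comp (s * t)%g.
Proof.
apply: spanprod_sub; first exact: context_direct_sum.1.
move=> [[a x] [y b]] [[a' x'] [y' b']].
move=> [[/= ha hx] [/= hy hb]] [[/= ha' hx'] [/= hy' hb']].
do 2?split=> /=.
- apply: (submoduleD (gcomp_submodule A _)); first exact: gcompM.
  by apply: gtauA; exact: spanprod_incl.
- apply: (submoduleD ((gX_direct_sum M).1 _)).
    by apply: gX_lact; exact: spanprod_incl.
  by apply: gX_ract; exact: spanprod_incl.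
- apply: (submoduleD ((gY_direct_sum M).1 _)).
    by apply: gY_ract; exact: spanprod_incl.
  by apply: gY_lact; exact: spanprod_incl.
- apply: (submoduleD (gcomp_submodule B _)); last exact: gcompM.
  by apply: gtauB; exact: spanprod_incl.
Qed.

Definition graded_context : gradedAlg k G :=
  GradedAlg context_direct_sum context_comp_mul.

Local Notation C := graded_context.
Local Notation q := (context_peirce M).

Let A0 t : gcomp A t 0. Proof. exact: submodule0 (gcomp_submodule A t). Qed.
Let B0 t : gcomp B t 0. Proof. exact: submodule0 (gcomp_submodule B t). Qed.
Let X0 t : gX M t 0. Proof. exact: submodule0 ((gX_direct_sum M).1 t). Qed.
Let Y0 t : gY M t 0. Proof. exact: submodule0 ((gY_direct_sum M).1 t). Qed.

Lemma context_pL_graded b t (u : C) : gcomp C t u -> gcomp C t (pL q b u).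
Proof. by case: u => -[a x] [y b'] [[? ?] [? ?]]; case: b. Qed.

Lemma context_pR_graded b t (u : C) : gcomp C t u -> gcomp C t (pR q b u).
Proof. by case: u => -[a x] [y b'] [[? ?] [? ?]]; case: b. Qed.

Lemma corner1_graded t a : gcomp A t a -> gcomp C t (corner1 M a). Proof. by []. Qed.
Lemma corner2_graded t b : gcomp B t b -> gcomp C t (corner2 M b). Proof. by []. Qed.

Let proj1 (u : C) : A := u.1.1.
Let proj2 (u : C) : B := u.2.2.
Let proj1_linear : linear proj1. Proof. by []. Qed.
Let proj2_linear : linear proj2. Proof. by []. Qed.

Definition graded_corner1 : graded_map A C :=
  @GradedMap k G A C _ (corner1_linear M) corner1_graded.
Definition graded_corner2 : graded_map B C :=
  @GradedMap k G B C _ (corner2_linear M) corner2_graded.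
Definition graded_proj1 : graded_map C A :=
  @GradedMap k G C A _ proj1_linear (fun t u hu => hu.1.1).
Definition graded_proj2 : graded_map C B :=
  @GradedMap k G C B _ proj2_linear (fun t u hu => hu.2.2).

Hypothesis hA : partially_strongly_graded A.
Hypothesis hB : partially_strongly_graded B.
Hypothesis hM : strong_graded_equivalence M.

Let hS := sge_strong hM.

(** Either diagonal idempotent can be inserted in C_t = C_t C_{t^-1} C_t: for
    e_true, the corners A_t, X_t, Y_t factor through A_t and A_{t^-1} by
    unitality, and B_t = D_t B_t = Y_t X_{t^-1} B_t. *)
Lemma context_refines b : refines (graded_pR context_pR_graded b).
Proof.
move=> t; set T := (X in _ `<=` X).
have hT : submodule T by exact: aprod_submodule.
have incl (u v w : C) : gcomp C t u -> pR q b u = u ->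
    gcomp C t^-1%g v -> gcomp C t w -> T (u ** v ** w).
  by move=> hu eu hv hw; do 2?apply: aprod_incl => //; exists u.
have sub1 : gcomp A t `<=` @corner1 k A B M @^-1` T.
  have hT' := submodule_preimage (corner1_linear M) hT.
  rewrite hA; case: b @T hT incl hT' => T hT incl hT'.
    apply: spanprod_nest_l => // [a|a a' a'' ha ha' ha'']; first exact: amulr_linear.
    by rewrite /= !corner1M; apply: incl.
  rewrite -/(gD A t) -(sge_DA hM).
  apply: spanprod_nest_l => // [a|x y a hx hy ha]; first exact: amulr_linear.
  by rewrite /= corner1M -cornerXY; apply: incl.
have sub2 : gcomp B t `<=` @corner2 k A B M @^-1` T.
  have hT' := submodule_preimage (corner2_linear M) hT.
  rewrite hB; case: b @T hT incl {sub1} hT' => T hT incl hT'.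
    rewrite -/(gD B t) -(sge_DB hM).
    apply: spanprod_nest_l => // [a|y x a hx hy ha]; first exact: amulr_linear.
    by rewrite /= corner2M -cornerYX; apply: incl.
  apply: spanprod_nest_l => // [a|a a' a'' ha ha' ha'']; first exact: amulr_linear.
  by rewrite /= !corner2M; apply: incl.
have subX : gX M t `<=` @cornerX k A B M @^-1` T.
  have hT' := submodule_preimage (cornerX_linear (M := M)) hT.
  case: b @T hT incl {sub1 sub2} hT' => T hT incl hT'.
    rewrite -(sgc_unitalX hS t).1.
    apply: spanprod_nest_l => // [x|a a' x ha ha' hx]; first exact: (lact_bilinear _).2.
    by rewrite /= -corner1X corner1M; apply: incl.
  rewrite -(sgc_unitalX hS t).2.
  apply: spanprod_nest_r => // [x|x a a' hx ha]; first exact: (ract_bilinear _).1.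
  by rewrite invgK => ha'; rewrite /= -cornerX2 corner2M amulA; apply: incl.
have subY : gY M t `<=` @cornerY k A B M @^-1` T.
  have hT' := submodule_preimage (cornerY_linear (M := M)) hT.
  case: b @T hT incl {sub1 sub2 subX} hT' => T hT incl hT'.
    rewrite -(sgc_unitalY hS t).2.
    apply: spanprod_nest_r => // [x|x a a' hx ha]; first exact: (ract_bilinear _).1.
    by rewrite invgK => ha'; rewrite /= -cornerY1 corner1M amulA; apply: incl.
  rewrite -(sgc_unitalY hS t).1.
  apply: spanprod_nest_l => // [x|a a' x ha ha' hx]; first exact: (lact_bilinear _).2.
  by rewrite /= -corner2Y corner2M; apply: incl.
move=> u [[ua ux] [uy ub]]; rewrite (context_decomp u).
by apply: (submoduleD hT); apply: (submoduleD hT);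
  [exact: sub1|exact: subX|exact: subY|exact: sub2].
Qed.

Lemma graded_context_partially_strong : partially_strongly_graded C.
Proof.
move=> t; apply/seteqP; split.
  apply: subset_trans (@context_refines true t) _.
  apply: aprodS => //; apply: aprodS => //.
  by move=> _ [u hu <-]; exact: context_pR_graded.
apply: aprod3_sub => [|x y z hx hy hz]; first exact: gcomp_submodule.
by have := gcompM (gcompM hx hy) hz; rewrite mulgV mul1g.
Qed.

(** By unitality an element of X_s is a sum of a a' x with a in A_s, a' in
    A_{s^-1} and x in X_s; then a' x is in X_1, and (a' x) y is in A_t for y in
    Y_t. *)
Lemma proj1_mul s t (u v : C) : gcomp C s u -> gcomp C t v ->
  aprod (gcomp A s) (gcomp A t) (graded_proj1 (u ** v)).
Proof.
case: u v => -[a x] [y b] [[a' x'] [y' b']] [[/= ha hx] _] [[/= ha' _] [/= hy' _]].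
have hT := aprod_submodule (gcomp A s) (gcomp A t).
apply: (submoduleD hT); first exact: aprod_incl.
have lin : linear ((tauA M)^~ y') by exact: (tauA_bilinear M).2.
move: x hx; rewrite -(sgc_unitalX hS s).1.
apply: (spanprod_nest_l (T := (tauA M)^~ y' @^-1` aprod (gcomp A s) (gcomp A t))).
- by move=> x; exact: (lact_bilinear _).2.
- exact: submodule_preimage.
move=> a1 a2 x h1 h2 hx; rewrite /= lactA tauA_lact; apply: aprod_incl => //.
rewrite -[t]mul1g -[1%g](mulVg s); apply: gtauA; apply: spanprod_incl => //.
by apply: gX_lact; exact: spanprod_incl.
Qed.

Lemma proj2_mul s t (u v : C) : gcomp C s u -> gcomp C t v ->
  aprod (gcomp B s) (gcomp B t) (graded_proj2 (u ** v)).
Proof.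
case: u v => -[a x] [y b] [[a' x'] [y' b']] [_ [/= hy hb]] [[/= _ hx'] [_ /= hb']].
have hT := aprod_submodule (gcomp B s) (gcomp B t).
apply: (submoduleD hT); last exact: aprod_incl.
have lin : linear ((tauB M)^~ x') by exact: (tauB_bilinear M).2.
move: y hy; rewrite -(sgc_unitalY hS s).1.
apply: (spanprod_nest_l (T := (tauB M)^~ x' @^-1` aprod (gcomp B s) (gcomp B t))).
- by move=> y; exact: (lact_bilinear _).2.
- exact: submodule_preimage.
move=> b1 b2 y h1 h2 hy; rewrite /= lactA tauB_lact; apply: aprod_incl => //.
rewrite -[t]mul1g -[1%g](mulVg s); apply: gtauB; apply: spanprod_incl => //.
by apply: gY_lact; exact: spanprod_incl.
Qed.

End GradedContext.

Theorem theorem7p15 (k : comPzRingType) (G : groupType) (A B : gradedAlg k G)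
    (M : gradedMoritaContext A B) :
  partially_strongly_graded A ->
  partially_strongly_graded B ->
  strong_graded_equivalence M ->
  morita_equivalent_pactions (canonical_paction A) (canonical_paction B).
Proof.
move=> hA hB hM.
have hC := graded_context_partially_strong hA hB hM.
have cA := canonical_corner_paction (@context_pL_graded _ _ _ _ M)
  (@context_pR_graded _ _ _ _ M) (b := true)
  (iota := graded_corner1 M) (proj := graded_proj1 M) hA.
have cB := canonical_corner_paction (@context_pL_graded _ _ _ _ M)
  (@context_pR_graded _ _ _ _ M) (b := false)
  (iota := graded_corner2 M) (proj := graded_proj2 M) hB.
apply: (corner_pactions_morita (smash_act_global _) (psmash_commuting hC) _ _ _
          (cA _ _ _ _ _ _) (cB _ _ _ _ _ _)).
- by apply: psmash_full; exact: context_refines.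
- by move=> t b x; exact: smash_map_act.
- by move=> t b x; exact: smash_map_act.
- exact: corner1M.
- by [].
- by [].
- by [].
- by move=> u lu ru; rewrite -lu -ru.
- exact: proj1_mul.
- exact: corner2M.
- by [].
- by [].
- by [].
- by move=> u lu ru; rewrite -lu -ru.
- exact: proj2_mul.
Qed.
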